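(* Let $\Omega\subset\mathbb{R}^3$ be an unbounded domain with $C^1$ boundary such that $\mathbb{R}^3\setminus\overline{\Omega}\neq\emptyset$, and let $\nu$ be the unit outer normal on $\partial\Omega$. Let $\mathbf{u}\in C^1(\Omega,\mathbb{R}^3)\cap C^0(\overline{\Omega},\mathbb{R}^3)$ satisfy $\operatorname{curl}\mathbf{u}\times\mathbf{u}=\mathbf{0}$ and $\operatorname{div}\mathbf{u}=0$ in $\Omega$, and $|\mathbf{u}(x)|=o(|x|^{-1})$ as $|x|\to+\infty$. Suppose in addition that either (i) $\Omega$ is star-shaped and $\mathbf{u}\times\nu=\mathbf{0}$ on $\partial\Omega$, or (ii) $\Omega=\mathbb{R}^3\setminus\overline{D}$ for some star-shaped domain $D\subset\mathbb{R}^3$ (bounded or unbounded), and $\mathbf{u}\cdot\nu=0$ on $\partial\Omega$. Then $\mathbf{u}\equiv\mathbf{0}$ in $\Omega$.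
   Context: A domain $D\subset\mathbb{R}^3$ is called star-shaped if there exists a point $x_0\in D$ such that for every $x\in\overline{D}$ the segment $\{tx_0+(1-t)x: t\in[0,1]\}$ lies in $\overline{D}$. *)

(* Defs.v *)
From Stdlib Require Import Reals.
Open Scope R_scope.

Record R3 := mkR3 { c1 : R; c2 : R; c3 : R }.

Inductive ax := A1 | A2 | A3.

Definition coord (v : R3) (i : ax) : R :=
  match i with A1 => c1 v | A2 => c2 v | A3 => c3 v end.

Definition vzero : R3 := mkR3 0 0 0.
Definition vadd (a b : R3) : R3 := mkR3 (c1 a + c1 b) (c2 a + c2 b) (c3 a + c3 b).
Definition vsub (a b : R3) : R3 := mkR3 (c1 a - c1 b) (c2 a - c2 b) (c3 a - c3 b).
Definition vscale (t : R) (a : R3) : R3 := mkR3 (t * c1 a) (t * c2 a) (t * c3 a).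
Definition dot (a b : R3) : R := c1 a * c1 b + c2 a * c2 b + c3 a * c3 b.
Definition cross (a b : R3) : R3 :=
  mkR3 (c2 a * c3 b - c3 a * c2 b)
       (c3 a * c1 b - c1 a * c3 b)
       (c1 a * c2 b - c2 a * c1 b).
Definition vnorm (a : R3) : R := sqrt (dot a a).
Definition basis (j : ax) : R3 :=
  match j with A1 => mkR3 1 0 0 | A2 => mkR3 0 1 0 | A3 => mkR3 0 0 1 end.

Definition ball (p : R3) (r : R) (x : R3) : Prop := vnorm (vsub x p) < r.

Definition is_open (U : R3 -> Prop) : Prop :=
  forall x, U x -> exists r, 0 < r /\ forall y, ball x r y -> U y.

Definition connected (U : R3 -> Prop) : Prop :=
  forall A B : R3 -> Prop, is_open A -> is_open B ->
    (forall x, U x -> A x \/ B x) ->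
    (forall x, ~ (U x /\ A x /\ B x)) ->
    (forall x, U x -> A x) \/ (forall x, U x -> B x).

Definition domain (U : R3 -> Prop) : Prop :=
  (exists x, U x) /\ is_open U /\ connected U.

Definition closure (U : R3 -> Prop) (x : R3) : Prop :=
  forall eps, 0 < eps -> exists y, U y /\ vnorm (vsub y x) < eps.

Definition boundary (U : R3 -> Prop) (x : R3) : Prop :=
  closure U x /\ closure (fun y => ~ U y) x.

Definition unbounded (U : R3 -> Prop) : Prop :=
  forall M, exists x, U x /\ M < vnorm x.

Definition star_shaped (D : R3 -> Prop) : Prop :=
  exists x0, D x0 /\
    forall x, closure D x -> forall t, 0 <= t <= 1 ->
      closure D (vadd (vscale t x0) (vscale (1 - t) x)).

Definition is_partial (f : R3 -> R) (j : ax) (x : R3) (l : R) : Prop :=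
  derivable_pt_lim (fun t => f (vadd x (vscale t (basis j)))) 0 l.

Definition cont_on (U : R3 -> Prop) (g : R3 -> R) : Prop :=
  forall x, U x -> forall eps, 0 < eps -> exists delta, 0 < delta /\
    forall y, U y -> vnorm (vsub y x) < delta -> Rabs (g y - g x) < eps.

Definition vcont_on (U : R3 -> Prop) (g : R3 -> R3) : Prop :=
  forall x, U x -> forall eps, 0 < eps -> exists delta, 0 < delta /\
    forall y, U y -> vnorm (vsub y x) < delta -> vnorm (vsub (g y) (g x)) < eps.

Definition C1_scalar_with (U : R3 -> Prop) (f : R3 -> R) (df : R3 -> ax -> R) : Prop :=
  (forall x, U x -> forall j, is_partial f j x (df x j)) /\
  (forall j, cont_on U (fun x => df x j)).

(* Du x i j = d u_i / d x_j (x); u is C^1 on U with Jacobian Du *)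
Definition C1_field_with (U : R3 -> Prop) (u : R3 -> R3) (Du : R3 -> ax -> ax -> R) : Prop :=
  forall i, C1_scalar_with U (fun x => coord (u x) i) (fun x j => Du x i j).

Definition C1_field (U : R3 -> Prop) (u : R3 -> R3) : Prop :=
  exists Du, C1_field_with U u Du.

Definition curl (Du : R3 -> ax -> ax -> R) (x : R3) : R3 :=
  mkR3 (Du x A3 A2 - Du x A2 A3)
       (Du x A1 A3 - Du x A3 A1)
       (Du x A2 A1 - Du x A1 A2).

Definition div (Du : R3 -> ax -> ax -> R) (x : R3) : R :=
  Du x A1 A1 + Du x A2 A2 + Du x A3 A3.

Definition grad (df : R3 -> ax -> R) (x : R3) : R3 := mkR3 (df x A1) (df x A2) (df x A3).

(* Omega has C^1 boundary and nu is its unit outer normal: near each boundary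
   point p, Omega = {rho < 0} for a C^1 local defining function rho with
   nonvanishing gradient, and nu p = grad rho p / |grad rho p|. *)
Definition C1_boundary_outer_normal (Om : R3 -> Prop) (nu : R3 -> R3) : Prop :=
  forall p, boundary Om p ->
    exists r (rho : R3 -> R) (drho : R3 -> ax -> R),
      0 < r /\
      C1_scalar_with (ball p r) rho drho /\
      (forall x, ball p r x -> grad drho x <> vzero) /\
      (forall x, ball p r x -> (Om x <-> rho x < 0)) /\
      nu p = vscale (/ vnorm (grad drho p)) (grad drho p).

Definition decay_o_inv (Om : R3 -> Prop) (u : R3 -> R3) : Prop :=
  forall eps, 0 < eps -> exists M, forall x, Om x -> M < vnorm x ->
    vnorm x * vnorm (u x) <= eps.

(* Main.v *)
(* Pohozaev-type argument.  With X = x - x0 the field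
   F = (u . X) u - |u|^2/2 X satisfies div F = -|u|^2/2 because curl u x u = 0
   and div u = 0, and F . nu >= 0 on the boundary by star-shapedness and the
   boundary condition.  Write q = (1 + |X|^2)^(-1/2), let A be a cutoff in q
   that is 0 for q <= c and 1 for q >= 2c, and multiply F by q A.  Since
   |X|^(-1) is the critical weight, the divergence theorem leaves only a
   boundary term of the good sign and an error supported in c <= q <= 2c, so
   the integral of q^3 A |u|^2 over Omega is at most a constant times the
   supremum of |u|^2 / q^2 there, which tends to 0 with c.

   No surface integral is needed.  Local defining functions are glued to one
   function sigma with Omega = {sigma < 0} on a large box, together with a C^1
   field N satisfying N . nu > 0 on the boundary.  For tau > 0 the field
   F + tau N points strictly outwards on the boundary, hence by compactness its
   product with grad sigma is nonnegative on a strip -eps < sigma < 0.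
   Multiplying by a cutoff eta that is a decreasing function of sigma and
   vanishes for sigma > -eps/2 gives a compactly supported C^1 field on R^3, and
   the term containing grad eta has a sign. *)
From Coquelicot Require Import Coquelicot.
From Stdlib Require Import Reals Lra Classical ClassicalEpsilon.
Require Import Defs.
Open Scope R_scope.

(** * Neighbourhoods and pointwise C^1 calculus *)

(** Neighbourhoods are taken in the sup norm, which fits coordinatewise arguments and cubes; the
    [Filter] instance below gives access to the general limit lemmas. *)
Definition near (x : R3) (P : R3 -> Prop) : Prop :=
  exists d, 0 < d /\
    forall y, (forall i, Rabs (coord y i - coord x i) < d) -> P y.

#[local] Instance near_filter (x : R3) : Filter (near x).
Proof.
split.
- exists 1. split; [lra | easy].
- intros P Q [d [Hd HP]] [e [He HQ]].
  exists (Rmin d e). split; [now apply Rmin_glb_lt|].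
  intros y Hy. split; [apply HP | apply HQ]; intros i;
    (eapply Rlt_le_trans; [apply Hy|]); [apply Rmin_l | apply Rmin_r].
- intros P Q H [d [Hd HP]]. exists d. auto.
Qed.

Lemma near_and {x : R3} {P Q : R3 -> Prop} :
  near x P -> near x Q -> near x (fun y => P y /\ Q y).
Proof. apply filter_and. Qed.

Lemma near_self (x : R3) (P : R3 -> Prop) : near x P -> P x.
Proof.
intros [d [Hd H]]. apply H. intros i. now rewrite Rminus_diag, Rabs_R0.
Qed.

Lemma near_near (x : R3) (P : R3 -> Prop) :
  near x P -> near x (fun y => near y P).
Proof.
intros [d [Hd H]]. exists (d / 2). split; [lra|].
intros y Hy. exists (d / 2). split; [lra|].
intros z Hz. apply H. intros i. specialize (Hy i). specialize (Hz i).
apply Rabs_def2 in Hy. apply Rabs_def2 in Hz. apply Rabs_def1; lra.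
Qed.

Lemma dot_self_ge0 (a : R3) : 0 <= dot a a.
Proof.
unfold dot. pose proof (Rle_0_sqr (c1 a)). pose proof (Rle_0_sqr (c2 a)).
pose proof (Rle_0_sqr (c3 a)). unfold Rsqr in *. lra.
Qed.

Lemma abs_coord_le_norm (v : R3) (i : ax) : Rabs (coord v i) <= vnorm v.
Proof.
rewrite <- sqrt_Rsqr_abs. apply sqrt_le_1_alt.
unfold dot, Rsqr. destruct i; simpl; nra.
Qed.

(** The constant [2] is a rational bound for the square root of 3. *)
Lemma norm_lt_twice (v : R3) (d : R) :
  (forall i, Rabs (coord v i) < d) -> vnorm v < 2 * d.
Proof.
intros H.
assert (H1 := H A1). assert (H2 := H A2). assert (H3 := H A3). simpl in *.
assert (Hd : 0 < d) by (pose proof (Rabs_pos (c1 v)); lra).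
apply Rabs_def2 in H1. apply Rabs_def2 in H2. apply Rabs_def2 in H3.
unfold vnorm. rewrite <- (sqrt_Rsqr (2 * d)) by lra.
apply sqrt_lt_1_alt. unfold dot, Rsqr. split; nra.
Qed.

Lemma coord_sub (a b : R3) (i : ax) : coord (vsub a b) i = coord a i - coord b i.
Proof. now destruct i. Qed.

Lemma near_of_norm (x : R3) (d : R) (P : R3 -> Prop) :
  0 < d -> (forall y, vnorm (vsub y x) < d -> P y) -> near x P.
Proof.
intros Hd H. exists (d / 2). split; [lra|].
intros y Hy. apply H. replace d with (2 * (d / 2)) by lra.
apply norm_lt_twice. intros i. rewrite coord_sub. apply Hy.
Qed.

Lemma norm_of_near (x : R3) (P : R3 -> Prop) :
  near x P -> exists d, 0 < d /\ forall y, vnorm (vsub y x) < d -> P y.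
Proof.
intros [d [Hd H]]. exists d. split; [easy|].
intros y Hy. apply H. intros i. rewrite <- coord_sub.
eapply Rle_lt_trans; [apply abs_coord_le_norm | easy].
Qed.

Lemma near_open (U : R3 -> Prop) (x : R3) : is_open U -> U x -> near x U.
Proof.
intros HU Hx. destruct (HU x Hx) as [r [Hr H]].
now apply (near_of_norm x r).
Qed.

Lemma near_ball (p : R3) (r : R) : 0 < r -> near p (ball p r).
Proof. intros Hr. now apply (near_of_norm p r). Qed.

Lemma closure_near (U : R3 -> Prop) (x : R3) (P : R3 -> Prop) :
  closure U x -> near x P -> exists y, U y /\ P y.
Proof.
intros HU HP. destruct (norm_of_near x P HP) as [d [Hd H]].
destruct (HU d Hd) as [y [Hy Hyd]]. exists y. auto.
Qed.

Lemma subset_closure (U : R3 -> Prop) (x : R3) : U x -> closure U x.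
Proof.
intros Hx e He. exists x. split; [easy|].
apply (near_self x (fun y => vnorm (vsub y x) < e)). now apply (near_of_norm x e).
Qed.

Lemma not_closure_near (U : R3 -> Prop) (x : R3) :
  ~ closure U x -> near x (fun y => ~ closure U y).
Proof.
intros H. unfold closure in H.
apply not_all_ex_not in H. destruct H as [e He].
apply imply_to_and in He. destruct He as [He Hn].
assert (N : near x (fun y => ~ U y)).
{ apply (near_of_norm x e); [easy|]. intros y Hy HU. apply Hn. now exists y. }
apply near_near in N. revert N. apply filter_imp.
intros y Hy Hc. destruct (closure_near U y _ Hc Hy) as [z [H1 H2]]. easy.
Qed.

(** * Continuity and C^1 regularity at a point *)

Definition cont (f : R3 -> R) (x : R3) : Prop :=
  filterlim f (near x) (locally (f x)).

Lemma cont_eps (f : R3 -> R) (x : R3) :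
  cont f x <-> forall e, 0 < e -> near x (fun y => Rabs (f y - f x) < e).
Proof.
split.
- intros H e He. apply (H (fun v => Rabs (v - f x) < e)).
  exists (mkposreal e He). intros v Hv. apply Hv.
- intros H P [e HP]. unfold filtermap. generalize (H e (cond_pos e)). apply filter_imp.
  intros y Hy. apply HP. apply Hy.
Qed.

Lemma cont_const (c : R) (x : R3) : cont (fun _ => c) x.
Proof. apply filterlim_const. Qed.

Lemma cont_coord (i : ax) (x : R3) : cont (fun y => coord y i) x.
Proof. apply cont_eps. intros e He. exists e. auto. Qed.

Lemma lim_plus {T} {F : (T -> Prop) -> Prop} {FF : Filter F} (f g : T -> R) (a b : R) :
  filterlim f F (locally a) -> filterlim g F (locally b) ->
  filterlim (fun y => f y + g y) F (locally (a + b)).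
Proof.
intros Hf Hg. apply (filterlim_comp_2 _ _ _ Hf Hg).
apply (filterlim_plus (K := R_AbsRing) (V := R_NormedModule)).
Qed.

Lemma lim_mult {T} {F : (T -> Prop) -> Prop} {FF : Filter F} (f g : T -> R) (a b : R) :
  filterlim f F (locally a) -> filterlim g F (locally b) ->
  filterlim (fun y => f y * g y) F (locally (a * b)).
Proof.
intros Hf Hg. apply (filterlim_comp_2 _ _ _ Hf Hg).
apply (filterlim_mult (K := R_AbsRing)).
Qed.

Lemma cont_plus (f g : R3 -> R) (x : R3) :
  cont f x -> cont g x -> cont (fun y => f y + g y) x.
Proof. apply lim_plus. Qed.

Lemma cont_mult (f g : R3 -> R) (x : R3) :
  cont f x -> cont g x -> cont (fun y => f y * g y) x.
Proof. apply lim_mult. Qed.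

Lemma cont_comp (h : R -> R) (f : R3 -> R) (x : R3) :
  continuity_pt h (f x) -> cont f x -> cont (fun y => h (f y)) x.
Proof.
intros Hh Hf. apply (filterlim_comp _ _ _ _ _ _ _ _ Hf).
now apply continuity_pt_filterlim.
Qed.

Lemma cont_ext_near (f g : R3 -> R) (x : R3) :
  near x (fun y => f y = g y) -> cont f x -> cont g x.
Proof.
intros E Hf. unfold cont. rewrite <- (near_self _ _ E).
now apply (filterlim_ext_loc f).
Qed.

Lemma cont_ext (f g : R3 -> R) (x : R3) :
  (forall y, f y = g y) -> cont f x -> cont g x.
Proof. intros E. apply cont_ext_near. now apply filter_forall. Qed.

Lemma cont_minus (f g : R3 -> R) (x : R3) :
  cont f x -> cont g x -> cont (fun y => f y - g y) x.
Proof.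
intros Hf Hg. apply (cont_ext (fun y => f y + (-1) * g y)); [intros; ring|].
apply cont_plus; [easy|]. apply cont_mult; [apply cont_const | easy].
Qed.

Lemma cont_gt_near (f : R3 -> R) (x : R3) (a : R) :
  cont f x -> a < f x -> near x (fun y => a < f y).
Proof.
intros Hf Ha. rewrite cont_eps in Hf.
generalize (Hf (f x - a) ltac:(lra)). apply filter_imp.
intros y Hy. apply Rabs_def2 in Hy. lra.
Qed.

Lemma cont_lt_near (f : R3 -> R) (x : R3) (a : R) :
  cont f x -> f x < a -> near x (fun y => f y < a).
Proof.
intros Hf Ha. rewrite cont_eps in Hf.
generalize (Hf (a - f x) ltac:(lra)). apply filter_imp.
intros y Hy. apply Rabs_def2 in Hy. lra.
Qed.

Lemma ball_open (p : R3) (r : R) (x : R3) : ball p r x -> near x (ball p r).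
Proof.
intros Hx.
assert (C : cont (fun y => vnorm (vsub y p)) x).
{ unfold vnorm. apply cont_comp.
  - apply continuity_pt_sqrt, dot_self_ge0.
  - unfold dot, vsub; simpl.
    assert (K : forall i, cont (fun y => coord y i - coord p i) x).
    { intros i. apply cont_minus; [apply cont_coord | apply cont_const]. }
    repeat apply cont_plus; apply cont_mult;
      first [exact (K A1) | exact (K A2) | exact (K A3)]. }
now apply (cont_lt_near _ _ _ C).
Qed.

(** A condition at the single point [x], so that C^1 on an open set becomes [C1p] at each of its
    points. Continuity of [f] is a separate field because partial derivatives at one point do not
    imply it. The gradient is carried explicitly so that divergences can be computed. *)
Record C1p (f : R3 -> R) (df : R3 -> ax -> R) (x : R3) : Prop := mkC1p {
  C1p_partial : forall j, is_partial f j x (df x j);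
  C1p_cont : cont f x;
  C1p_dcont : forall j, cont (fun y => df y j) x }.

Lemma vadd_scale0 (x v : R3) : vadd x (vscale 0 v) = x.
Proof.
destruct x, v. unfold vadd, vscale. simpl. f_equal; ring.
Qed.

Lemma near_line (x v : R3) (P : R3 -> Prop) :
  near x P -> locally 0 (fun t => P (vadd x (vscale t v))).
Proof.
intros [d [Hd H]].
pose proof (Rabs_pos (c1 v)). pose proof (Rabs_pos (c2 v)). pose proof (Rabs_pos (c3 v)).
set (m := 1 + Rabs (c1 v) + Rabs (c2 v) + Rabs (c3 v)).
assert (Hm : 0 < m) by (unfold m; lra).
exists (mkposreal (d / m) (Rdiv_lt_0_compat _ _ Hd Hm)).
intros t Ht. apply H. intros i.
change (Rabs (t - 0) < d / m) in Ht. rewrite Rminus_0_r in Ht.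
replace (coord (vadd x (vscale t v)) i - coord x i) with (t * coord v i)
  by (destruct i; simpl; ring).
rewrite Rabs_mult.
assert (Hi : Rabs (coord v i) <= m) by (destruct i; unfold m; simpl; lra).
apply Rle_lt_trans with (Rabs t * m).
- apply Rmult_le_compat_l; [apply Rabs_pos | easy].
- apply Rmult_lt_compat_r with (r := m) in Ht; [|easy].
  replace (d / m * m) with d in Ht by (field; lra). easy.
Qed.

Lemma is_partial_ext_near (f g : R3 -> R) (j : ax) (x : R3) (l : R) :
  near x (fun y => f y = g y) -> is_partial f j x l -> is_partial g j x l.
Proof.
intros E H. apply is_derive_Reals. apply is_derive_Reals in H.
revert H. apply is_derive_ext_loc. exact (near_line x (basis j) _ E).
Qed.

Lemma C1p_ext_near (f g : R3 -> R) (df dg : R3 -> ax -> R) (x : R3) :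
  near x (fun y => f y = g y /\ forall j, df y j = dg y j) ->
  C1p f df x -> C1p g dg x.
Proof.
intros E [H1 H2 H3]. pose proof (near_self _ _ E) as [_ E0].
split.
- intros j. rewrite <- E0. apply (is_partial_ext_near f); [|easy].
  revert E. now apply filter_imp.
- apply (cont_ext_near f); [|easy]. revert E. now apply filter_imp.
- intros j. apply (cont_ext_near (fun y => df y j)); [|easy].
  revert E. now apply filter_imp.
Qed.

Lemma C1p_ext (f g : R3 -> R) (df dg : R3 -> ax -> R) (x : R3) :
  (forall y, f y = g y) -> (forall y j, df y j = dg y j) ->
  C1p f df x -> C1p g dg x.
Proof.
intros E1 E2. apply C1p_ext_near. apply filter_forall. auto.
Qed.

Lemma C1p_const (c : R) (x : R3) : C1p (fun _ => c) (fun _ _ => 0) x.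
Proof.
split; intros; try apply cont_const.
unfold is_partial. apply derivable_pt_lim_const.
Qed.

Definition delta (i j : ax) : R :=
  match i, j with A1, A1 | A2, A2 | A3, A3 => 1 | _, _ => 0 end.

Lemma C1p_coord (i : ax) (x : R3) :
  C1p (fun y => coord y i) (fun _ j => delta i j) x.
Proof.
split.
- intros j. unfold is_partial. apply is_derive_Reals.
  apply (is_derive_ext (fun t => coord x i + t * delta i j)).
  + intros t. destruct i, j; simpl; ring.
  + auto_derive; [easy | ring].
- apply cont_coord.
- intros j. apply cont_const.
Qed.

Lemma C1p_plus (f g : R3 -> R) (df dg : R3 -> ax -> R) (x : R3) :
  C1p f df x -> C1p g dg x ->
  C1p (fun y => f y + g y) (fun y j => df y j + dg y j) x.
Proof.
intros [H1 H2 H3] [K1 K2 K3]. split.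
- intros j. exact (derivable_pt_lim_plus _ _ _ _ _ (H1 j) (K1 j)).
- now apply cont_plus.
- intros j. now apply cont_plus.
Qed.

Lemma C1p_mult (f g : R3 -> R) (df dg : R3 -> ax -> R) (x : R3) :
  C1p f df x -> C1p g dg x ->
  C1p (fun y => f y * g y) (fun y j => df y j * g y + f y * dg y j) x.
Proof.
intros [H1 H2 H3] [K1 K2 K3]. split.
- intros j. pose proof (derivable_pt_lim_mult _ _ _ _ _ (H1 j) (K1 j)) as M.
  cbv beta in M. rewrite vadd_scale0 in M. exact M.
- now apply cont_mult.
- intros j. apply cont_plus; apply cont_mult; auto.
Qed.

Lemma C1p_minus (f g : R3 -> R) (df dg : R3 -> ax -> R) (x : R3) :
  C1p f df x -> C1p g dg x ->
  C1p (fun y => f y - g y) (fun y j => df y j - dg y j) x.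
Proof.
intros Hf Hg.
apply (C1p_ext (fun y => f y + (-1) * g y) _
  (fun y j => df y j + (0 * g y + (-1) * dg y j))); [intros; ring | intros; ring |].
apply C1p_plus; [easy|].
apply (C1p_mult (fun _ => -1) g (fun _ _ => 0)); [apply C1p_const | easy].
Qed.

Lemma C1p_comp (h h' : R -> R) (f : R3 -> R) (df : R3 -> ax -> R) (x : R3) :
  derivable_pt_lim h (f x) (h' (f x)) ->
  continuity_pt h' (f x) ->
  C1p f df x -> C1p (fun y => h (f y)) (fun y j => h' (f y) * df y j) x.
Proof.
intros Hh Hh' [H1 H2 H3]. split.
- intros j. unfold is_partial.
  apply (derivable_pt_lim_comp
    (fun t => f (vadd x (vscale t (basis j)))) h 0).
  + apply H1.
  + rewrite vadd_scale0. apply Hh.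
- apply cont_comp; [|easy]. apply derivable_continuous_pt. now exists (h' (f x)).
- intros j. apply cont_mult; [|easy]. now apply cont_comp.
Qed.

(** * First-order expansions and compactness of cubes *)

Definition upd (x : R3) (k : ax) (t : R) : R3 :=
  match k with
  | A1 => mkR3 t (c2 x) (c3 x)
  | A2 => mkR3 (c1 x) t (c3 x)
  | A3 => mkR3 (c1 x) (c2 x) t
  end.

Lemma coord_upd_same (x : R3) (k : ax) (t : R) : coord (upd x k t) k = t.
Proof. now destruct k. Qed.

Lemma coord_upd_other (x : R3) (k i : ax) (t : R) :
  i <> k -> coord (upd x k t) i = coord x i.
Proof. now destruct k, i. Qed.

Lemma upd_coord (x : R3) (k : ax) : upd x k (coord x k) = x.
Proof. now destruct x, k. Qed.

Lemma upd_upd (x : R3) (k : ax) (s t : R) : upd (upd x k s) k t = upd x k t.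
Proof. now destruct k. Qed.

Lemma upd_comm (x : R3) (j k : ax) (s t : R) :
  j <> k -> upd (upd x j s) k t = upd (upd x k t) j s.
Proof. now destruct j, k. Qed.

Lemma ax_eq_dec (i j : ax) : {i = j} + {i <> j}.
Proof. decide equality. Qed.

(** Converts a derivative at parameter 0 into a derivative in the coordinate itself, the form used
    by the mean value theorem and by integration along an axis. *)
Lemma is_partial_upd (f : R3 -> R) (j : ax) (x : R3) (l : R) :
  is_partial f j x l <-> is_derive (fun t => f (upd x j t)) (coord x j) l.
Proof.
assert (E : forall t, vadd x (vscale t (basis j)) = upd x j (coord x j + t)).
{ intros t. destruct j; unfold vadd, vscale; simpl; f_equal; ring. }
unfold is_partial. rewrite <- is_derive_Reals. split; intros H.
- apply (is_derive_ext (fun t => f (vadd x (vscale (t - coord x j) (basis j))))).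
  { intros t. rewrite E. do 2 f_equal. simpl; ring. }
  replace l with (scal 1 l) by (unfold scal; simpl; unfold mult; simpl; ring).
  apply (is_derive_comp (fun t => f (vadd x (vscale t (basis j))))
    (fun t => t - coord x j)).
  + now rewrite Rminus_diag.
  + auto_derive; [easy | ring].
- apply (is_derive_ext (fun t => f (upd x j (coord x j + t)))).
  { intros t. now rewrite E. }
  replace l with (scal 1 l) by (unfold scal; simpl; unfold mult; simpl; ring).
  apply (is_derive_comp (fun t => f (upd x j t)) (fun t => coord x j + t)).
  + now rewrite Rplus_0_r.
  + auto_derive; [easy | ring].
Qed.

Lemma increment_bound (f : R3 -> R) (df : R3 -> ax -> R) (z : R3) (j : ax) (b l e : R) :
  (forall t, Rmin (coord z j) b <= t <= Rmax (coord z j) b ->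
     is_partial f j (upd z j t) (df (upd z j t) j) /\
     Rabs (df (upd z j t) j - l) <= e) ->
  Rabs (f (upd z j b) - f z - l * (b - coord z j)) <= e * Rabs (b - coord z j).
Proof.
intros H.
assert (D : forall t, Rmin (coord z j) b <= t <= Rmax (coord z j) b ->
  is_derive (fun s => f (upd z j s)) t (df (upd z j t) j)).
{ intros t Ht. destruct (H t Ht) as [Hp _]. apply is_partial_upd in Hp.
  rewrite coord_upd_same in Hp. revert Hp. apply is_derive_ext.
  intros s. now rewrite upd_upd. }
destruct (MVT_gen (fun s => f (upd z j s)) (coord z j) b
  (fun t => df (upd z j t) j)) as [c [Hc E]].
- intros t Ht. apply D. lra.
- intros t Ht. apply derivable_continuous_pt. exists (df (upd z j t) j).
  apply is_derive_Reals. now apply D.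
- cbv beta in E. rewrite upd_coord in E. rewrite E.
  replace (df (upd z j c) j * (b - coord z j) - l * (b - coord z j))
    with ((df (upd z j c) j - l) * (b - coord z j)) by ring.
  rewrite Rabs_mult. apply Rmult_le_compat_r; [apply Rabs_pos|].
  now apply H.
Qed.

(** The classical proof that continuous partial derivatives give differentiability: go from [x] to
    [y] along three axis-parallel segments and apply the mean value theorem on each. *)
Lemma first_order_expansion (f : R3 -> R) (df : R3 -> ax -> R) (x : R3) (e : R) :
  near x (fun y => forall j, is_partial f j y (df y j)) ->
  (forall j, cont (fun y => df y j) x) -> 0 < e ->
  near x (fun y => Rabs (f y - f x - dot (grad df x) (vsub y x)) <=
    e * (Rabs (c1 y - c1 x) + Rabs (c2 y - c2 x) + Rabs (c3 y - c3 x))).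
Proof.
intros Hp Hc He.
assert (N : near x (fun y => forall j,
  is_partial f j y (df y j) /\ Rabs (df y j - df x j) <= e)).
{ assert (Hc' : forall j, near x (fun y => Rabs (df y j - df x j) < e)).
  { intros j. now apply (proj1 (cont_eps _ _) (Hc j)). }
  generalize (near_and Hp (near_and (Hc' A1)
    (near_and (Hc' A2) (Hc' A3)))).
  apply filter_imp. intros y (H0 & H1 & H2 & H3) j.
  split; [apply H0|]. destruct j; lra. }
destruct N as [d [Hd H]]. exists d. split; [easy|].
intros y Hy.
assert (B : forall j t, Rmin (coord x j) (coord y j) <= t <= Rmax (coord x j) (coord y j) ->
  Rabs (t - coord x j) < d).
{ intros j t Ht. specialize (Hy j). apply Rabs_def2 in Hy.
  unfold Rmin, Rmax in Ht. destruct (Rle_dec (coord x j) (coord y j));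
    apply Rabs_def1; lra. }
assert (Y1 := Hy A1). assert (Y2 := Hy A2). simpl in Y1, Y2.
assert (Z : Rabs 0 < d) by (now rewrite Rabs_R0).
pose proof (increment_bound f df x A1 (c1 y) (df x A1) e) as I1.
pose proof (increment_bound f df (mkR3 (c1 y) (c2 x) (c3 x)) A2 (c2 y) (df x A2) e) as I2.
pose proof (increment_bound f df (mkR3 (c1 y) (c2 y) (c3 x)) A3 (c3 y) (df x A3) e) as I3.
simpl in I1, I2, I3.
assert (J1 := I1 ltac:(intros t Ht; apply H; intros []; simpl;
  rewrite ?Rminus_diag; auto; now apply (B A1))). clear I1.
assert (J2 := I2 ltac:(intros t Ht; apply H; intros []; simpl;
  rewrite ?Rminus_diag; auto; now apply (B A2))). clear I2.
assert (J3 := I3 ltac:(intros t Ht; apply H; intros []; simpl;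
  rewrite ?Rminus_diag; auto; now apply (B A3))). clear I3.
replace (mkR3 (c1 y) (c2 y) (c3 y)) with y in J3 by now destruct y.
unfold grad, dot, vsub; simpl.
match type of J1 with Rabs ?a <= _ => set (A := a) in * end.
match type of J2 with Rabs ?a <= _ => set (B' := a) in * end.
match type of J3 with Rabs ?a <= _ => set (C := a) in * end.
match goal with |- Rabs ?a <= _ => replace a with (A + B' + C)
  by (unfold A, B', C; ring) end.
pose proof (Rabs_triang (A + B') C). pose proof (Rabs_triang A B'). lra.
Qed.

(** Continuity of [f] comes from the first-order expansion: the linear part [g] and the error [a]
    both tend to 0 at [x]. *)
Lemma C1p_of_partials (f : R3 -> R) (df : R3 -> ax -> R) (x : R3) :
  near x (fun y => forall j, is_partial f j y (df y j)) ->
  (forall j, cont (fun y => df y j) x) -> C1p f df x.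
Proof.
intros Hp Hc. split; [exact (near_self _ _ Hp) | | easy].
set (g := fun y => dot (grad df x) (vsub y x)).
set (a := fun y => Rabs (c1 y - c1 x) + Rabs (c2 y - c2 x) + Rabs (c3 y - c3 x)).
assert (K : forall i, cont (fun y => coord y i - coord x i) x).
{ intros i. apply cont_minus; [apply cont_coord | apply cont_const]. }
assert (Cg : cont g x).
{ unfold g, dot; simpl.
  repeat apply cont_plus; (apply cont_mult; [apply cont_const|]);
    first [exact (K A1) | exact (K A2) | exact (K A3)]. }
assert (Ca : cont a x).
{ unfold a. repeat apply cont_plus; apply cont_comp;
    first [apply Rcontinuity_abs | exact (K A1) | exact (K A2) | exact (K A3)]. }
assert (g0 : g x = 0) by (unfold g, dot; simpl; ring).
assert (a0 : a x = 0) by (unfold a; rewrite !Rminus_diag, Rabs_R0; ring).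
apply cont_eps. intros e He.
rewrite cont_eps in Cg, Ca.
generalize (near_and (first_order_expansion f df x 1 Hp Hc ltac:(lra))
  (near_and (Cg (e / 2) ltac:(lra)) (Ca (e / 2) ltac:(lra)))).
apply filter_imp. intros y (H1 & H2 & H3).
fold (g y) in H1. fold (a y) in H1. rewrite g0 in H2. rewrite a0 in H3.
apply Rabs_le_between in H1. apply Rabs_def2 in H2. apply Rabs_def2 in H3.
apply Rabs_def1; lra.
Qed.

Lemma C1p_of_scalar (U : R3 -> Prop) (f : R3 -> R) (df : R3 -> ax -> R) (x : R3) :
  near x U -> C1_scalar_with U f df -> C1p f df x.
Proof.
intros HU [H1 H2]. apply C1p_of_partials.
- revert HU. apply filter_imp. auto.
- intros j. apply cont_eps. intros e He.
  destruct (H2 j x (near_self _ _ HU) e He) as [d [Hd H]].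
  generalize (near_and HU (near_of_norm x d _ Hd (fun y Hy => Hy))).
  apply filter_imp. intros y [K1 K2]. auto.
Qed.

Lemma ray_expansion (f : R3 -> R) (df : R3 -> ax -> R) (x v : R3) (e : R) :
  near x (fun y => C1p f df y) -> 0 < e ->
  locally 0 (fun t => Rabs (f (vadd x (vscale t v)) - f x - t * dot (grad df x) v)
    <= e * Rabs t).
Proof.
intros N He.
pose proof (Rabs_pos (c1 v)). pose proof (Rabs_pos (c2 v)). pose proof (Rabs_pos (c3 v)).
set (m := 1 + Rabs (c1 v) + Rabs (c2 v) + Rabs (c3 v)).
assert (Hm : 0 < m) by (unfold m; lra).
(* [m] exceeds the l^1 norm of [v], so an l^1 error with factor [e / m] becomes at most [e * Rabs t]
   along the ray. *)
assert (He' : 0 < e / m) by now apply Rdiv_lt_0_compat.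
assert (P : near x (fun y => forall j, is_partial f j y (df y j))).
{ revert N. apply filter_imp. now intros y []. }
generalize (near_line x v _ (first_order_expansion f df x (e / m) P
  (C1p_dcont _ _ _ (near_self _ _ N)) He')).
apply filter_imp. intros t. simpl.
replace (c1 x + t * c1 v - c1 x) with (t * c1 v) by ring.
replace (c2 x + t * c2 v - c2 x) with (t * c2 v) by ring.
replace (c3 x + t * c3 v - c3 x) with (t * c3 v) by ring.
replace (dot (grad df x) (vsub (vadd x (vscale t v)) x))
  with (t * dot (grad df x) v) by (unfold dot, vsub; simpl; ring).
intros Ht. eapply Rle_trans; [apply Ht|]. rewrite !Rabs_mult.
apply Rle_trans with (e / m * (Rabs t * m)).
- apply Rmult_le_compat_l; [lra|]. unfold m. pose proof (Rabs_pos t). nra.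
- right. field. lra.
Qed.

(** An error of at most half the slope [l] leaves an increase of at least [l / 2 * t]. *)
Lemma ray_increases (f : R3 -> R) (df : R3 -> ax -> R) (x v : R3) :
  near x (fun y => C1p f df y) -> 0 < dot (grad df x) v ->
  exists d, 0 < d /\ forall t, 0 < t < d -> f x < f (vadd x (vscale t v)).
Proof.
intros N Hv. set (l := dot (grad df x) v) in *.
destruct (ray_expansion f df x v (l / 2) N ltac:(lra)) as [d Hd].
exists d. split; [apply cond_pos|]. intros t Ht.
assert (B : Hierarchy.ball (0 : R_UniformSpace) d t).
{ change (Rabs (t - 0) < d). rewrite Rminus_0_r, Rabs_pos_eq; lra. }
specialize (Hd t B). fold l in Hd.
rewrite (Rabs_pos_eq t) in Hd by lra.
apply Rabs_le_between in Hd. nra.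
Qed.

Lemma dot_oppr (a b : R3) : dot a (vscale (-1) b) = - dot a b.
Proof. unfold dot, vscale; simpl; ring. Qed.

Lemma ray_decreases (f : R3 -> R) (df : R3 -> ax -> R) (x v : R3) :
  near x (fun y => C1p f df y) -> dot (grad df x) v < 0 ->
  exists d, 0 < d /\ forall t, 0 < t < d -> f (vadd x (vscale t v)) < f x.
Proof.
intros N Hv.
destruct (ray_increases (fun y => 0 - f y) (fun y j => 0 - df y j) x v) as [d [Hd H]].
- revert N. apply filter_imp. intros y.
  apply (C1p_minus (fun _ => 0) f (fun _ _ => 0)), C1p_const.
- unfold dot, grad in *; simpl in *; lra.
- exists d. split; [easy|]. intros t Ht. specialize (H t Ht). cbv beta in H. lra.
Qed.

(** * Compactness of closed cubes *)

Definition in_cube (p : R3) (L : R) (x : R3) : Prop :=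
  forall i, Rabs (coord x i - coord p i) <= L.

Definition in_box (p : R3) (d : R) (x : R3) : Prop :=
  forall i, Rabs (coord x i - coord p i) < d.

(** Heine-Borel as a principle of uniformity: if [P y d] survives shrinking [d] and holds locally
    with some [d], then one [d] works on the whole cube. *)
Lemma cube_compact (p : R3) (L : R) (P : R3 -> R -> Prop) :
  (forall t, in_cube p L t ->
     exists d, 0 < d /\ forall y, in_box t d y -> P y d) ->
  (forall y d e, P y d -> 0 < e <= d -> P y e) ->
  exists d, 0 < d /\ forall y, in_cube p L y -> P y d.
Proof.
intros H Hm.
set (T := Compactness.Tn 3 R).
set (pt := fun t : T => let '(a, (b, (c, _))) := t in mkR3 a b c).
assert (C : forall t : T, exists d : posreal, in_cube p L (pt t) ->
  forall y, in_box (pt t) d y -> P y d).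
{ intros t. destruct (classic (in_cube p L (pt t))) as [Ht|Ht].
  - destruct (H _ Ht) as [d [Hd K]]. now exists (mkposreal d Hd).
  - now exists (mkposreal 1 Rlt_0_1). }
(* A gauge on all triples, chosen by indefinite description; compactness bounds it below along a
   suitable choice of centres. *)
set (dl := fun t => proj1_sig (constructive_indefinite_description _ (C t))).
set (a := (c1 p - L, (c2 p - L, (c3 p - L, tt))) : T).
set (b := (c1 p + L, (c2 p + L, (c3 p + L, tt))) : T).
destruct (compactness_value 3 a b dl) as [d Hd].
exists d. split; [apply cond_pos|]. intros y Hy.
assert (B : bounded_n 3 a b (c1 y, (c2 y, (c3 y, tt)))).
{ assert (Y1 := Hy A1). assert (Y2 := Hy A2). assert (Y3 := Hy A3).
  simpl in Y1, Y2, Y3. apply Rabs_le_between in Y1.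
  apply Rabs_le_between in Y2. apply Rabs_le_between in Y3.
  simpl. repeat split; lra. }
(* The compactness result yields its centre only under a double negation. *)
apply NNPP. intros NP. apply (Hd _ B). intros [[t1 [t2 [t3 []]]] (K1 & K2 & K3)].
apply NP. apply (Hm y (dl (t1, (t2, (t3, tt))))).
- unfold dl. destruct (constructive_indefinite_description _ _) as [d' Hd'] eqn:E.
  simpl. apply Hd'.
  + simpl in K1. intros []; simpl; apply Rabs_le_between'; lra.
  + simpl in K2. unfold dl in K2. rewrite E in K2. simpl in K2.
    intros []; simpl; tauto.
- split; [apply cond_pos | easy].
Qed.

Lemma near_cube_compact (p : R3) (L : R) (P : R3 -> R -> Prop) :
  (forall t, in_cube p L t -> exists d, 0 < d /\ near t (fun y => P y d)) ->
  (forall y d e, P y d -> 0 < e <= d -> P y e) ->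
  exists d, 0 < d /\ forall y, in_cube p L y -> P y d.
Proof.
intros H Hm. apply cube_compact; [|easy].
intros t Ht. destruct (H t Ht) as [d [Hd [e [He K]]]].
exists (Rmin d e). split; [now apply Rmin_glb_lt|].
intros y Hy. apply (Hm y d).
- apply K. intros i. eapply Rlt_le_trans; [apply Hy | apply Rmin_r].
- split; [now apply Rmin_glb_lt | apply Rmin_l].
Qed.

Lemma cont_cube_bounded (f : R3 -> R) (p : R3) (L : R) :
  (forall x, in_cube p L x -> cont f x) ->
  exists C, 0 < C /\ forall x, in_cube p L x -> Rabs (f x) <= C.
Proof.
intros Hf.
destruct (near_cube_compact p L (fun y d => Rabs (f y) <= / d)) as [d [Hd H]].
- intros t Ht. exists (/ (Rabs (f t) + 1)).
  pose proof (Rabs_pos (f t)).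
  split; [apply Rinv_0_lt_compat; lra|].
  generalize (proj1 (cont_eps f t) (Hf t Ht) 1 Rlt_0_1). apply filter_imp.
  intros y Hy. rewrite Rinv_inv. pose proof (Rabs_triang_inv (f y) (f t)). lra.
- intros y d e Hy [He Hed]. eapply Rle_trans; [apply Hy|].
  now apply Rinv_le_contravar.
- exists (/ d). split; [now apply Rinv_0_lt_compat | easy].
Qed.

(** * Iterated integrals over a cube *)

Lemma cont_line (f : R3 -> R) (x : R3) (k : ax) (t : R) :
  cont f (upd x k t) -> continuous (fun s => f (upd x k s)) t.
Proof.
intros Hf. unfold continuous. refine (filterlim_comp _ _ _ _ f _ _ _ _ Hf).
intros P [d [Hd H]]. exists (mkposreal d Hd). intros s Hs. apply H.
intros i. destruct (ax_eq_dec i k) as [->|Hi].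
- rewrite !coord_upd_same. apply Hs.
- rewrite !coord_upd_other, Rminus_diag, Rabs_R0; easy.
Qed.

Section Integral.

Variables (p : R3) (L : R).
Hypothesis HL : 0 <= L.

(** The result is again a function on [R3], constant in direction [k], so integrations along
    different axes compose without a change of type. *)
Definition int_ax (k : ax) (f : R3 -> R) (x : R3) : R :=
  RInt (fun t => f (upd x k t)) (coord p k - L) (coord p k + L).

Definition int_cube (f : R3 -> R) : R :=
  int_ax A1 (int_ax A2 (int_ax A3 f)) p.

Lemma ex_RInt_line (f : R3 -> R) (k : ax) (x : R3) (a b : R) :
  (forall y, cont f y) -> ex_RInt (fun t => f (upd x k t)) a b.
Proof.
intros Hf. apply (ex_RInt_continuous (V := R_CompleteNormedModule)).
intros t _. now apply cont_line.
Qed.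

(** By compactness the integrand is close to its value on the line through [x], uniformly along the
    segment of integration. *)
Lemma int_ax_cont (k : ax) (f : R3 -> R) (x : R3) :
  (forall y, cont f y) -> cont (int_ax k f) x.
Proof.
intros Hf. apply cont_eps. intros e He.
set (e' := e / (2 * L + 1)).
assert (He' : 0 < e') by (apply Rdiv_lt_0_compat; lra).
(* Only coordinate [k] of the compactness variable [y] matters; it plays the role of the integration
   parameter. *)
destruct (cube_compact p L (fun y d => forall z, in_box x d z ->
  Rabs (f (upd z k (coord y k)) - f (upd x k (coord y k))) <= e')) as [d [Hd H]].
- intros t _. set (w := upd x k (coord t k)).
  destruct (proj1 (cont_eps f w) (Hf w) (e' / 2) ltac:(lra)) as [d [Hd H]].
  exists d. split; [easy|]. intros y Hy z Hz.
  assert (K : forall v, in_box x d v -> in_box w d (upd v k (coord y k))).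
  { intros v Hv i. unfold w. destruct (ax_eq_dec i k) as [->|Hi].
    - rewrite !coord_upd_same. apply Hy.
    - rewrite !coord_upd_other by easy. apply Hv. }
  assert (K1 := H _ (K z Hz)).
  assert (K2 := H (upd x k (coord y k))
    ltac:(apply K; intros i; rewrite Rminus_diag, Rabs_R0; easy)).
  apply Rabs_def2 in K1. apply Rabs_def2 in K2. apply Rabs_le_between. lra.
- intros y d e0 H [_ Hed] z Hz. apply H. intros i.
  eapply Rlt_le_trans; [apply Hz | easy].
- exists d. split; [easy|]. intros z Hz. unfold int_ax.
  change (Rabs (minus (RInt (fun t => f (upd z k t)) (coord p k - L) (coord p k + L))
    (RInt (fun t => f (upd x k t)) (coord p k - L) (coord p k + L))) < e).
  rewrite <- (RInt_minus (V := R_CompleteNormedModule)) by now apply ex_RInt_line.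
  eapply Rle_lt_trans.
  + apply abs_RInt_le_const with (M := e'); [lra | |].
    * apply (ex_RInt_minus (V := R_NormedModule)); now apply ex_RInt_line.
    * intros t Ht.
      assert (Hq : in_cube p L (upd p k t)).
      { intros i. destruct (ax_eq_dec i k) as [->|Hi].
        - rewrite coord_upd_same. apply Rabs_le_between'. lra.
        - rewrite coord_upd_other, Rminus_diag, Rabs_R0; easy. }
      generalize (H _ Hq z Hz). now rewrite coord_upd_same.
  + replace (coord p k + L - (coord p k - L)) with (2 * L) by ring.
    replace e with ((2 * L + 1) * e') by (unfold e'; field; lra). lra.
Qed.

(** Differentiation under the integral sign, in a direction transversal to the integration. *)
Lemma int_ax_partial (j k : ax) (f g : R3 -> R) :
  j <> k -> (forall y, cont f y) -> (forall y, cont g y) ->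
  (forall y, is_partial f j y (g y)) ->
  forall x, is_partial (int_ax k f) j x (int_ax k g x).
Proof.
intros Hjk Cf Cg Hd x. apply is_partial_upd. unfold int_ax.
set (a := coord p k - L). set (b := coord p k + L).
assert (D : forall s t, is_derive (fun s => f (upd (upd x j s) k t)) s
  (g (upd (upd x j s) k t))).
{ intros s t. generalize (proj1 (is_partial_upd _ _ _ _) (Hd (upd (upd x j s) k t))).
  rewrite coord_upd_other, coord_upd_same by easy.
  apply is_derive_ext. intros s'. f_equal.
  now rewrite (upd_comm x j k s), upd_upd, upd_comm. }
replace (RInt (fun t => g (upd x k t)) a b)
  with (RInt (fun t => Derive (fun s => f (upd (upd x j s) k t)) (coord x j)) a b).
2:{ apply RInt_ext. intros t _. etransitivity; [apply is_derive_unique, D|].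
    now rewrite upd_coord. }
apply (is_derive_RInt_param (fun s t => f (upd (upd x j s) k t)) a b (coord x j)).
- apply filter_forall. intros s t _. eexists. apply D.
- intros t _. apply (continuity_2d_pt_ext (fun s t => g (upd (upd x j s) k t))).
  { intros s u. symmetry. apply is_derive_unique, D. }
  intros e.
  destruct (proj1 (cont_eps g _) (Cg (upd (upd x j (coord x j)) k t)) e (cond_pos e))
    as [d [Hd' H]].
  exists (mkposreal d Hd'). intros u v Hu Hv. apply H.
  intros i. destruct (ax_eq_dec i k) as [->|Hi].
  + now rewrite !coord_upd_same.
  + rewrite !(coord_upd_other _ k) by easy.
    destruct (ax_eq_dec i j) as [->|Hj].
    * now rewrite !coord_upd_same.
    * rewrite !coord_upd_other, Rminus_diag, Rabs_R0; easy.
- apply filter_forall. intros s. now apply ex_RInt_line.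
Qed.

Lemma int_ax_of_partial (k : ax) (f g : R3 -> R) (x : R3) :
  (forall y, is_partial f k y (g y)) -> (forall y, cont g y) ->
  int_ax k g x = f (upd x k (coord p k + L)) - f (upd x k (coord p k - L)).
Proof.
intros Hd Cg. apply is_RInt_unique.
apply (is_RInt_derive (V := R_CompleteNormedModule) (fun t => f (upd x k t))).
- intros t _. generalize (proj1 (is_partial_upd _ _ _ _) (Hd (upd x k t))).
  rewrite coord_upd_same. apply is_derive_ext. intros s. now rewrite upd_upd.
- intros t _. now apply cont_line.
Qed.

Lemma int_ax_0 (k : ax) (f : R3 -> R) (x : R3) :
  (forall t, f (upd x k t) = 0) -> int_ax k f x = 0.
Proof.
intros H. unfold int_ax. rewrite (RInt_ext _ (fun _ => 0)) by (intros; apply H).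
rewrite RInt_const. unfold scal; simpl; unfold mult; simpl. ring.
Qed.

(** This is the divergence theorem for one component vanishing on the faces orthogonal to [j]. The
    derivative is moved outside the inner integrals, then the fundamental theorem of calculus is
    applied in direction [j]; the order of integration never changes. *)
Lemma int_cube_partial (j : ax) (f g : R3 -> R) :
  (forall y, cont f y) -> (forall y, cont g y) ->
  (forall y, is_partial f j y (g y)) ->
  (forall y, Rabs (coord y j - coord p j) = L -> f y = 0) ->
  int_cube g = 0.
Proof.
intros Cf Cg Hd H0. unfold int_cube.
assert (Z1 : forall y, f (upd y j (coord p j + L)) = 0).
{ intros y. apply H0. rewrite coord_upd_same.
  replace (coord p j + L - coord p j) with L by ring. now apply Rabs_pos_eq. }
assert (Z2 : forall y, f (upd y j (coord p j - L)) = 0).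
{ intros y. apply H0. rewrite coord_upd_same.
  replace (coord p j - L - coord p j) with (- L) by ring.
  rewrite Rabs_Ropp. now apply Rabs_pos_eq. }
destruct j.
- rewrite (int_ax_of_partial A1 (int_ax A2 (int_ax A3 f))).
  + rewrite 2!int_ax_0; [ring | |];
      intros t; apply int_ax_0; intros s; [apply (Z2 (mkR3 0 t s)) | apply (Z1 (mkR3 0 t s))].
  + apply int_ax_partial; try easy; intros y;
      try now (apply int_ax_cont; intros; apply int_ax_cont).
    * now apply int_ax_cont.
    * now apply int_ax_cont.
    * now apply int_ax_partial.
  + intros y. apply int_ax_cont. intros. now apply int_ax_cont.
- apply int_ax_0. intros t.
  rewrite (int_ax_of_partial A2 (int_ax A3 f)).
  + rewrite 2!int_ax_0; [ring | |];
      intros s; [apply (Z2 (mkR3 t 0 s)) | apply (Z1 (mkR3 t 0 s))].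
  + now apply int_ax_partial.
  + intros y. now apply int_ax_cont.
- apply int_ax_0. intros t. apply int_ax_0. intros s.
  rewrite (int_ax_of_partial A3 f) by easy. rewrite Z1, Z2. ring.
Qed.

Lemma int_cube_le (f g : R3 -> R) :
  (forall y, cont f y) -> (forall y, cont g y) ->
  (forall y, in_cube p L y -> f y <= g y) -> int_cube f <= int_cube g.
Proof.
intros Cf Cg H. unfold int_cube.
apply RInt_le; [lra | | |].
1,2: apply ex_RInt_line; intros; apply int_ax_cont; intros; now apply int_ax_cont.
intros x Hx. apply RInt_le; [lra | | |].
1,2: apply ex_RInt_line; intros; now apply int_ax_cont.
intros y Hy. apply RInt_le; [lra | | |].
1,2: now apply ex_RInt_line.
intros z Hz. apply H. simpl in *.
intros []; simpl; apply Rabs_le_between'; lra.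
Qed.

Lemma int_cube_const (c : R) : int_cube (fun _ => c) = c * (2 * L) ^ 3.
Proof.
unfold int_cube, int_ax. rewrite !RInt_const. unfold scal; simpl; unfold mult; simpl. ring.
Qed.

Lemma int_cube_lin (a : R) (f g : R3 -> R) :
  (forall y, cont f y) -> (forall y, cont g y) ->
  int_cube (fun y => a * f y + g y) = a * int_cube f + int_cube g.
Proof.
assert (S : forall k f g x, (forall y, cont f y) -> (forall y, cont g y) ->
  int_ax k (fun y => a * f y + g y) x = a * int_ax k f x + int_ax k g x).
{ intros k f' g' x Cf Cg. unfold int_ax.
  change (a * RInt (fun t => f' (upd x k t)) (coord p k - L) (coord p k + L))
    with (scal a (RInt (fun t => f' (upd x k t)) (coord p k - L) (coord p k + L))).
  rewrite <- (RInt_scal (V := R_CompleteNormedModule)) by now apply ex_RInt_line.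
  apply (RInt_plus (V := R_CompleteNormedModule)).
  - apply (ex_RInt_scal (V := R_NormedModule)). now apply ex_RInt_line.
  - now apply ex_RInt_line. }
intros Cf Cg. unfold int_cube.
rewrite <- S by (intros; apply int_ax_cont; intros; now apply int_ax_cont).
apply RInt_ext. intros x _.
rewrite <- S by (intros; now apply int_ax_cont).
apply RInt_ext. intros y _. now apply S.
Qed.

Lemma RInt_lower (g : R -> R) (a b c d m : R) :
  (forall t, continuous g t) -> a <= c <= d -> d <= b ->
  (forall t, a < t < b -> 0 <= g t) -> (forall t, c < t < d -> m <= g t) ->
  m * (d - c) <= RInt g a b.
Proof.
intros Cg Hc Hd H0 Hm.
assert (E : forall x y, ex_RInt g x y).
{ intros x y. apply (ex_RInt_continuous (V := R_CompleteNormedModule)). auto. }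
rewrite <- (RInt_Chasles g a c b) by apply E.
rewrite <- (RInt_Chasles g c d b) by apply E.
assert (I1 : 0 <= RInt g a c).
{ apply RInt_ge_0; [lra | apply E |]. intros; apply H0; lra. }
assert (I2 : 0 <= RInt g d b).
{ apply RInt_ge_0; [lra | apply E |]. intros; apply H0; lra. }
assert (I3 : RInt (fun _ => m) c d <= RInt g c d).
{ apply RInt_le; [lra | apply ex_RInt_const | apply E | easy]. }
rewrite RInt_const in I3. unfold scal in I3; simpl in I3; unfold mult in I3; simpl in I3.
unfold plus; simpl. lra.
Qed.

(** For a nonnegative integrand, the part of the cube outside the smaller cube can be discarded, one
    coordinate at a time. *)
Lemma int_cube_lower (f : R3 -> R) (q : R3) (r m : R) :
  (forall y, cont f y) -> 0 <= r -> (forall y, in_cube q r y -> in_cube p L y) ->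
  (forall y, in_cube p L y -> 0 <= f y) ->
  (forall y, in_cube q r y -> m <= f y) ->
  m * (2 * r) ^ 3 <= int_cube f.
Proof.
intros Cf Hr Hq H0 Hm.
assert (B : forall k, coord p k - L <= coord q k - r /\ coord q k + r <= coord p k + L).
{ intros k.
  (* Inclusion of cubes is read off one axis at a time, from points that differ from [q] in a single
     coordinate. *)
  assert (K : forall s, Rabs (s - coord q k) <= r -> Rabs (s - coord p k) <= L).
  { intros s Hs. specialize (Hq (upd q k s)).
    rewrite <- (coord_upd_same q k s). apply Hq. intros i.
    destruct (ax_eq_dec i k) as [->|Hi].
    - now rewrite coord_upd_same.
    - now rewrite coord_upd_other, Rminus_diag, Rabs_R0. }
  assert (K1 := K (coord q k - r) ltac:(apply Rabs_le_between'; lra)).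
  assert (K2 := K (coord q k + r) ltac:(apply Rabs_le_between'; lra)).
  apply Rabs_le_between' in K1. apply Rabs_le_between' in K2. lra. }
assert (Ln : forall k h x t, (forall y, cont h y) -> continuous (fun s => h (upd x k s)) t).
{ intros. now apply cont_line. }
assert (M : forall x1 x2 x3,
  coord p A1 - L < x1 < coord p A1 + L -> coord p A2 - L < x2 < coord p A2 + L ->
  coord p A3 - L < x3 < coord p A3 + L -> 0 <= f (mkR3 x1 x2 x3)).
{ intros x1 x2 x3 K1 K2 K3. apply H0. intros []; apply Rabs_le_between'; simpl in *; lra. }
assert (B1 := B A1). assert (B2 := B A2). assert (B3 := B A3).
replace (m * (2 * r) ^ 3) with
  (m * ((coord q A3 + r) - (coord q A3 - r)) * ((coord q A2 + r) - (coord q A2 - r))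
    * ((coord q A1 + r) - (coord q A1 - r))) by ring.
unfold int_cube. apply RInt_lower; try lra.
- intros t. apply Ln. intros; apply int_ax_cont; intros; now apply int_ax_cont.
- intros x1 K1. apply RInt_ge_0; [lra | |].
  { apply ex_RInt_line. intros; now apply int_ax_cont. }
  intros x2 K2. apply RInt_ge_0; [lra | now apply ex_RInt_line |].
  intros x3 K3. now apply M.
- intros x1 K1. apply RInt_lower; try lra.
  + intros t. apply Ln. intros; now apply int_ax_cont.
  + intros x2 K2. apply RInt_ge_0; [lra | now apply ex_RInt_line |].
    intros x3 K3. apply M; simpl in *; lra.
  + intros x2 K2. apply RInt_lower; try lra.
    * intros t. now apply Ln.
    * intros x3 K3. apply M; simpl in *; lra.
    * intros x3 K3. apply Hm. intros []; apply Rabs_le_between'; simpl in *; lra.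
Qed.

End Integral.

(** * Global defining functions *)

(** The building block of a piecewise quadratic C^1 cutoff, whose properties reduce to case splits
    on signs. *)
Lemma derivable_pt_lim_mul_abs (t : R) :
  derivable_pt_lim (fun s => s * Rabs s) t (2 * Rabs t).
Proof.
apply is_derive_Reals. destruct (Rtotal_order t 0) as [H|[->|H]].
- apply (is_derive_ext_loc (fun s => - (s * s))).
  + apply (locally_interval _ t m_infty 0); [easy.. |]. simpl. intros s _ Hs.
    rewrite (Rabs_left s) by easy. ring.
  + rewrite (Rabs_left t) by easy. auto_derive; [easy | ring].
- apply is_derive_Reals. rewrite Rabs_R0, Rmult_0_r. intros e He.
  exists (mkposreal e He). intros h Hh Hhe. simpl in Hhe.
  replace (((0 + h) * Rabs (0 + h) - 0 * Rabs 0) / h - 0) with (Rabs h).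
  + now rewrite Rabs_Rabsolu.
  + rewrite Rplus_0_l. field. easy.
- apply (is_derive_ext_loc (fun s => s * s)).
  + apply (locally_interval _ t 0 p_infty); [easy.. |]. simpl. intros s Hs _.
    now rewrite (Rabs_pos_eq s) by lra.
  + rewrite (Rabs_pos_eq t) by lra. auto_derive; [easy | ring].
Qed.

(* The C^1 step whose derivative is the hat function supported on [0, 1]. *)
Definition step (t : R) : R :=
  1 / 2 + (t * Rabs t - 2 * ((t - 1 / 2) * Rabs (t - 1 / 2)) + (t - 1) * Rabs (t - 1)).
Definition step' (t : R) : R :=
  2 * Rabs t - 4 * Rabs (t - 1 / 2) + 2 * Rabs (t - 1).

Ltac split_abs :=
  unfold step, step', Rabs in *; repeat destruct Rcase_abs; try nra.

Lemma step_lo (t : R) : t <= 0 -> step t = 0 /\ step' t = 0.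
Proof. intros H; split_abs. Qed.

Lemma step_hi (t : R) : 1 <= t -> step t = 1 /\ step' t = 0.
Proof. intros H; split_abs. Qed.

Lemma step_bounds (t : R) : 0 <= step t <= 1.
Proof. split_abs. Qed.

Lemma step'_bounds (t : R) : 0 <= step' t <= 2.
Proof. split_abs. Qed.

Lemma step'_ne0 (t : R) : step' t <> 0 -> 0 < t < 1.
Proof.
intros H. destruct (Rle_lt_dec t 0) as [H0|H0]; [now destruct (step_lo t H0)|].
destruct (Rle_lt_dec 1 t) as [H1|H1]; [now destruct (step_hi t H1) | easy].
Qed.

Lemma step_derive (t : R) : derivable_pt_lim step t (step' t).
Proof.
assert (S : forall a, derivable_pt_lim (fun s => (s - a) * Rabs (s - a)) t (2 * Rabs (t - a))).
{ intros a. apply is_derive_Reals.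
  replace (2 * Rabs (t - a)) with (scal 1 (2 * Rabs (t - a)))
    by (unfold scal; simpl; unfold mult; simpl; ring).
  apply (is_derive_comp (fun s => s * Rabs s) (fun s => s - a)).
  - apply is_derive_Reals, derivable_pt_lim_mul_abs.
  - auto_derive; [easy | ring]. }
replace (step' t) with (0 + (2 * Rabs t - 2 * (2 * Rabs (t - 1 / 2)) + 2 * Rabs (t - 1)))
  by (unfold step'; ring).
apply (derivable_pt_lim_plus (fun _ => 1 / 2)); [apply derivable_pt_lim_const|].
apply (derivable_pt_lim_plus (fun s => s * Rabs s - 2 * ((s - 1 / 2) * Rabs (s - 1 / 2))));
  [|apply S].
apply (derivable_pt_lim_minus (fun s => s * Rabs s)).
- apply derivable_pt_lim_mul_abs.
- apply (derivable_pt_lim_scal (fun s => (s - 1 / 2) * Rabs (s - 1 / 2))), S.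
Qed.

Lemma step'_continuous (t : R) : continuity_pt step' t.
Proof. unfold step'. reg. Qed.

Lemma C1p_affine_comp (h h' : R -> R) (a b : R) (f : R3 -> R) (df : R3 -> ax -> R) (x : R3) :
  (forall t, derivable_pt_lim h t (h' t)) -> (forall t, continuity_pt h' t) ->
  C1p f df x ->
  C1p (fun y => h (a * f y + b)) (fun y j => h' (a * f y + b) * (a * df y j)) x.
Proof.
intros Hh Hh' Hf.
apply (C1p_comp h h' (fun y => a * f y + b) (fun y j => a * df y j)); auto.
eapply C1p_ext; [intros; reflexivity | | apply C1p_plus;
  [apply C1p_mult; [apply (C1p_const a) | exact Hf] | apply (C1p_const b)]].
intros; simpl; ring.
Qed.

Lemma C1_cutoff (j : ax) (a b : R) :
  a < b -> exists psi dpsi, (forall x, C1p psi dpsi x) /\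
    (forall x, 0 <= psi x <= 1) /\
    (forall x, coord x j <= a -> psi x = 0 /\ forall i, dpsi x i = 0) /\
    (forall x, b <= coord x j -> psi x = 1 /\ forall i, dpsi x i = 0).
Proof.
intros Hab. set (k := / (b - a)).
assert (Hk : 0 < k) by (apply Rinv_0_lt_compat; lra).
assert (Ek : k * (b - a) = 1) by (unfold k; field; lra).
exists (fun y => step (k * coord y j + - (k * a))).
exists (fun y i => step' (k * coord y j + - (k * a)) * (k * delta j i)).
split; [|split; [|split]].
- intros x. apply (C1p_affine_comp step step' k (- (k * a)) (fun y => coord y j)
    (fun _ i => delta j i)).
  + apply step_derive.
  + apply step'_continuous.
  + apply C1p_coord.
- intros x. apply step_bounds.
- intros x Hx. destruct (step_lo (k * coord x j + - (k * a))) as [H1 H2]; [nra|].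
  split; [easy|]. intros i. rewrite H2. ring.
- intros x Hx. destruct (step_hi (k * coord x j + - (k * a))) as [H1 H2]; [nra|].
  split; [easy|]. intros i. rewrite H2. ring.
Qed.

(** * Gradients of defining functions and the outer normal *)

Lemma dot_self_eq0 (w : R3) : dot w w <= 0 -> w = vzero.
Proof.
destruct w as [a b c]. unfold dot, vzero; simpl. intros H.
assert (a = 0) by nra. assert (b = 0) by nra. assert (c = 0) by nra. congruence.
Qed.

Lemma dot_self_gt0 (w : R3) : w <> vzero -> 0 < dot w w.
Proof.
intros H. destruct (Rlt_le_dec 0 (dot w w)) as [|H']; [easy|].
now apply dot_self_eq0 in H'.
Qed.

Lemma vadd_vsub (w b : R3) : vadd w (vsub b w) = b.
Proof. destruct w, b. unfold vadd, vsub. simpl. f_equal; ring. Qed.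

(** Write [b] as [lam] times [a] plus [w] with [w] orthogonal to [a]. Testing with [w - s a] for
    small [s > 0] shows that the square of [w] is at most [s] times [dot a b], hence [w = 0]. *)
Lemma half_space_parallel (a b : R3) :
  a <> vzero -> b <> vzero -> (forall v, dot a v < 0 -> dot b v <= 0) ->
  exists lam, 0 < lam /\ b = vscale lam a.
Proof.
intros Ha Hb H. apply dot_self_gt0 in Ha.
set (lam := dot a b / dot a a).
assert (El : lam * dot a a = dot a b) by (unfold lam; field; lra).
set (w := vsub b (vscale lam a)).
assert (Haw : dot a w = 0).
{ transitivity (dot a b - lam * dot a a); [|lra].
  unfold w, dot, vsub, vscale; simpl; ring. }
assert (Hbw : dot b w = dot w w).
{ transitivity (dot w w + lam * dot a w); [|rewrite Haw; ring].
  unfold w, dot, vsub, vscale; simpl; ring. }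
assert (Hab : 0 <= dot a b).
{ assert (K := H (vscale (-1) a)). rewrite !dot_oppr in K.
  replace (dot b a) with (dot a b) in K by (unfold dot; ring). lra. }
assert (Hw : w = vzero).
{ apply dot_self_eq0. apply Rle_plus_epsilon. intros e He.
  set (s := e / (dot a b + 1)).
  assert (Hs : 0 < s) by (apply Rdiv_lt_0_compat; lra).
  assert (Es : s * (dot a b + 1) = e) by (unfold s; field; lra).
  assert (K := H (vsub w (vscale s a))).
  replace (dot a (vsub w (vscale s a))) with (dot a w - s * dot a a) in K
    by (unfold dot, vsub, vscale; simpl; ring).
  replace (dot b (vsub w (vscale s a))) with (dot b w - s * dot a b) in K
    by (unfold dot, vsub, vscale; simpl; ring).
  rewrite Haw, Hbw in K. nra. }
assert (E : b = vscale lam a).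
{ rewrite <- (vadd_vsub (vscale lam a) b). fold w. rewrite Hw.
  unfold vadd, vscale, vzero; simpl. f_equal; ring. }
exists lam. split; [|easy].
destruct (Rlt_le_dec 0 lam) as [|Hl]; [easy|]. exfalso. apply Hb.
assert (lam = 0) by nra.
rewrite E. subst lam. rewrite H0. unfold vscale, vzero. f_equal; ring.
Qed.

Section Boundary.

Variables (Om : R3 -> Prop) (nu : R3 -> R3).
Hypotheses (Om_open : is_open Om) (Om_bd : C1_boundary_outer_normal Om nu).

Lemma boundary_not_in (x : R3) : boundary Om x -> ~ Om x.
Proof.
intros [_ Hc] Hx.
now destruct (closure_near _ x _ Hc (near_open Om x Om_open Hx)).
Qed.

Definition defines_near (rho : R3 -> R) (drho : R3 -> ax -> R) (x : R3) : Prop :=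
  near x (fun y => C1p rho drho y) /\ near x (fun y => Om y <-> rho y < 0).

Lemma boundary_rho_eq0 (rho : R3 -> R) (drho : R3 -> ax -> R) (x : R3) :
  boundary Om x -> defines_near rho drho x -> rho x = 0.
Proof.
intros Hb [C D]. apply Rle_antisym.
- apply Rnot_lt_le. intros H.
  assert (N := cont_gt_near _ _ _ (C1p_cont _ _ _ (near_self _ _ C)) H).
  destruct (closure_near _ _ _ (proj1 Hb) (near_and D N)) as [y [Hy [K1 K2]]].
  apply K1 in Hy. lra.
- apply Rnot_lt_le. intros H. apply (boundary_not_in x Hb).
  now apply (near_self _ _ D).
Qed.

Lemma boundary_chart (p : R3) :
  boundary Om p -> exists r rho drho, 0 < r /\
    (forall x, ball p r x -> defines_near rho drho x /\ grad drho x <> vzero) /\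
    nu p = vscale (/ vnorm (grad drho p)) (grad drho p).
Proof.
intros Hp. destruct (Om_bd p Hp) as (r & rho & drho & Hr & HC & Hg & Hd & Hn).
exists r, rho, drho. split; [easy|]. split; [|easy].
intros x Hx. split; [|auto].
assert (Nx := ball_open p r x Hx). split.
- generalize (near_near _ _ Nx). apply filter_imp.
  intros y Hy. now apply (C1p_of_scalar (ball p r)).
- revert Nx. apply filter_imp. auto.
Qed.

Lemma vnorm_gt0 (v : R3) : v <> vzero -> 0 < vnorm v.
Proof. intros H. apply sqrt_lt_R0. now apply dot_self_gt0. Qed.

(** All defining functions have the same normal direction: a ray along which the chart function
    decreases enters [Om], so [rho] cannot increase along it, and [half_space_parallel] applies. *)
Lemma gradient_normal (rho : R3 -> R) (drho : R3 -> ax -> R) (x : R3) :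
  boundary Om x -> defines_near rho drho x -> grad drho x <> vzero ->
  exists lam, 0 < lam /\ grad drho x = vscale lam (nu x).
Proof.
intros Hb Hd Hg.
destruct (boundary_chart x Hb) as (r & tau & dtau & Hr & Ht & Hn).
destruct (Ht x (near_self _ _ (near_ball x r Hr))) as [Hdt Hgt].
destruct (half_space_parallel (grad dtau x) (grad drho x)) as [lam [Hl E]]; try easy.
- intros v Hv. apply Rnot_lt_le. intros Hv'.
  destruct (ray_decreases tau dtau x v (proj1 Hdt) Hv) as [d [Hd0 K]].
  destruct (ray_increases rho drho x v (proj1 Hd) Hv') as [e [He0 K']].
  rewrite (boundary_rho_eq0 _ _ x Hb Hdt) in K.
  rewrite (boundary_rho_eq0 _ _ x Hb Hd) in K'.
  destruct (near_line x v _ (near_and (proj2 Hdt) (proj2 Hd))) as [s Hs].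
  set (t := Rmin (Rmin d e) s / 2).
  assert (Ht0 : 0 < Rmin (Rmin d e) s).
  { apply Rmin_glb_lt; [now apply Rmin_glb_lt | apply cond_pos]. }
  pose proof (Rmin_l (Rmin d e) s). pose proof (Rmin_r (Rmin d e) s).
  pose proof (Rmin_l d e). pose proof (Rmin_r d e).
  assert (B : Hierarchy.ball (0 : R_UniformSpace) s t).
  { change (Rabs (t - 0) < s). rewrite Rminus_0_r, Rabs_pos_eq; unfold t; lra. }
  destruct (Hs t B) as [S1 S2].
  specialize (K t ltac:(unfold t; lra)). specialize (K' t ltac:(unfold t; lra)).
  apply S1 in K. apply S2 in K. lra.
- pose proof (vnorm_gt0 _ Hgt).
  exists (lam * vnorm (grad dtau x)). split; [now apply Rmult_lt_0_compat|].
  rewrite Hn, E. unfold vscale; simpl. f_equal; field; lra.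
Qed.

(* sg vanishes on the boundary and only the direction of its gradient matters
   there, so both boundary conditions survive gluing with a variable convex weight. *)
Definition chart_at (sg : R3 -> R) (dsg : R3 -> ax -> R)
  (N : R3 -> R3) (DN : R3 -> ax -> ax -> R) (x : R3) : Prop :=
  C1p sg dsg x /\
  (forall i, C1p (fun y => coord (N y) i) (fun y j => DN y i j) x) /\
  (Om x <-> sg x < 0) /\
  (boundary Om x -> sg x = 0 /\
     (exists lam, 0 < lam /\ grad dsg x = vscale lam (nu x)) /\
     0 < dot (N x) (nu x)).

Definition has_chart (S : R3 -> Prop) : Prop :=
  exists sg dsg N DN, forall x, S x -> chart_at sg dsg N DN x.

Lemma has_chart_mono (S T : R3 -> Prop) :
  (forall x, S x -> T x) -> has_chart T -> has_chart S.
Proof.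
intros H (sg & dsg & N & DN & K). exists sg, dsg, N, DN. auto.
Qed.

Lemma has_chart_const (c : R) (v : R3) (S : R3 -> Prop) :
  (forall x, S x -> (Om x <-> c < 0)) -> (forall x, S x -> ~ boundary Om x) ->
  has_chart S.
Proof.
intros H1 H2.
exists (fun _ => c), (fun _ _ => 0), (fun _ => v), (fun _ _ _ => 0).
intros x Hx. split; [apply C1p_const|]. split; [intros; apply C1p_const|].
split; [now apply H1|]. intros Hb. now destruct (H2 x Hx).
Qed.

(** Inside [Om] and away from its closure a constant serves as defining function; at a boundary
    point the given local function is used, with the constant field [nu t] as [N]. *)
Lemma has_chart_local (t : R3) :
  exists r, 0 < r /\ has_chart (in_box t r).
Proof.
destruct (classic (Om t)) as [Ht|Ht].
{ destruct (near_open Om t Om_open Ht) as [r [Hr H]].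
  exists r. split; [easy|]. apply (has_chart_const (-1) vzero).
  - intros x Hx. split; [intros; lra | intros _; now apply H].
  - intros x Hx Hb. apply (boundary_not_in x Hb). now apply H. }
destruct (classic (closure Om t)) as [Hc|Hc].
2:{ destruct (not_closure_near Om t Hc) as [r [Hr H]].
  exists r. split; [easy|].
  apply (has_chart_const 1 vzero).
  - intros x Hx. split; [intros Hx'; destruct (H x Hx); now apply subset_closure | lra].
  - intros x Hx [Hb _]. now apply (H x Hx). }
assert (Hb : boundary Om t).
{ split; [easy|]. now apply subset_closure. }
destruct (boundary_chart t Hb) as (r & rho & drho & Hr & Hrho & Hn).
assert (Nb := near_ball t r Hr).
destruct (Hrho t (near_self _ _ Nb)) as [Hd0 Hg0].
(* Positivity of [dot (nu t) (nu x)] at nearby boundary points is obtained through the gradient,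
   which is continuous and a positive multiple of [nu x] there. *)
assert (Cd : cont (fun y => dot (nu t) (grad drho y)) t).
{ destruct (near_self _ _ (proj1 Hd0)) as [_ _ Cj]. unfold dot, grad; simpl.
  apply cont_plus; [apply cont_plus|]; (apply cont_mult; [apply cont_const | apply Cj]). }
assert (Pd : 0 < dot (nu t) (grad drho t)).
{ rewrite Hn. pose proof (vnorm_gt0 _ Hg0). pose proof (dot_self_gt0 _ Hg0).
  replace (dot _ _) with (/ vnorm (grad drho t) * dot (grad drho t) (grad drho t))
    by (unfold dot, vscale; simpl; ring).
  apply Rmult_lt_0_compat; [now apply Rinv_0_lt_compat | easy]. }
destruct (near_and Nb (cont_gt_near _ _ _ Cd Pd)) as [s [Hs K]].
exists s. split; [easy|].
exists rho, drho, (fun _ => nu t), (fun _ _ _ => 0).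
intros x Hx. destruct (K x Hx) as [K1 K2].
destruct (Hrho x K1) as [Hd Hg].
split; [exact (near_self _ _ (proj1 Hd))|].
split; [intros; apply C1p_const|].
split; [exact (near_self _ _ (proj2 Hd))|].
intros Hbx. split; [now apply (boundary_rho_eq0 rho drho)|].
destruct (gradient_normal rho drho x Hbx Hd Hg) as [lam [Hl E]].
split; [now exists lam|].
rewrite E in K2.
replace (dot (nu t) (vscale lam (nu x))) with (lam * dot (nu t) (nu x)) in K2
  by (unfold dot, vscale; simpl; ring).
nra.
Qed.

(** Interpolates between two charts across the slab [a < coord x j < b], with a weight depending on
    that coordinate only. *)
Lemma has_chart_glue (S : R3 -> Prop) (j : ax) (a b : R) :
  a < b ->
  has_chart (fun x => S x /\ coord x j < b) ->
  has_chart (fun x => S x /\ a < coord x j) ->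
  has_chart S.
Proof.
intros Hab (s1 & d1 & N1 & D1 & H1) (s2 & d2 & N2 & D2 & H2).
(* The weight varies only in the middle third, where both charts are available; outside it is
   locally constant, so regularity of one chart is enough. *)
set (a' := a + (b - a) / 3). set (b' := b - (b - a) / 3).
destruct (C1_cutoff j a' b') as (psi & dpsi & P & Pb & Pl & Ph);
  [unfold a', b'; lra|].
pose (mix f g := fun y : R3 => f y + psi y * (g y - f y)).
pose (dmix f (df : R3 -> ax -> R) g dg := fun (y : R3) (i : ax) =>
  df y i + (dpsi y i * (g y - f y) + psi y * (dg y i - df y i))).
assert (Cl : forall f df g dg x, coord x j < a' ->
  C1p f df x -> C1p (mix f g) (dmix f df g dg) x).
{ intros f df g dg x Hx. apply C1p_ext_near.
  generalize (cont_lt_near _ _ _ (cont_coord j x) Hx). apply filter_imp.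
  intros y Hy. destruct (Pl y ltac:(lra)) as [E1 E2].
  unfold mix, dmix. split; [rewrite E1; ring | intros i; rewrite E1, E2; ring]. }
assert (Ch : forall f df g dg x, b' < coord x j ->
  C1p g dg x -> C1p (mix f g) (dmix f df g dg) x).
{ intros f df g dg x Hx. apply C1p_ext_near.
  generalize (cont_gt_near _ _ _ (cont_coord j x) Hx). apply filter_imp.
  intros y Hy. destruct (Ph y ltac:(lra)) as [E1 E2].
  unfold mix, dmix. split; [rewrite E1; ring | intros i; rewrite E1, E2; ring]. }
assert (Cm : forall f df g dg x,
  C1p f df x -> C1p g dg x -> C1p (mix f g) (dmix f df g dg) x).
{ intros f df g dg x Hf Hg. apply C1p_plus; [easy|].
  apply C1p_mult; [easy | now apply C1p_minus]. }
exists (mix s1 s2), (dmix s1 d1 s2 d2).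
exists (fun y => mkR3 (mix (fun z => c1 (N1 z)) (fun z => c1 (N2 z)) y)
  (mix (fun z => c2 (N1 z)) (fun z => c2 (N2 z)) y)
  (mix (fun z => c3 (N1 z)) (fun z => c3 (N2 z)) y)).
exists (fun y i => dmix (fun z => coord (N1 z) i) (fun z => D1 z i)
  (fun z => coord (N2 z) i) (fun z => D2 z i) y).
intros x Sx.
assert (V : (coord x j < a' /\ chart_at s1 d1 N1 D1 x /\ psi x = 0 /\ forall i, dpsi x i = 0) \/
  (b' < coord x j /\ chart_at s2 d2 N2 D2 x /\ psi x = 1 /\ forall i, dpsi x i = 0) \/
  (chart_at s1 d1 N1 D1 x /\ chart_at s2 d2 N2 D2 x)).
{ destruct (Rlt_le_dec (coord x j) a').
  { left. split; [easy|]. split; [apply H1; unfold a' in *; split; [easy|lra]|].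
    apply Pl. lra. }
  destruct (Rlt_le_dec b' (coord x j)).
  { right; left. split; [easy|]. split; [apply H2; unfold b' in *; split; [easy|lra]|].
    apply Ph. lra. }
  right; right. split; [apply H1 | apply H2]; unfold a', b' in *; split; (easy || lra). }
split; [|split; [|split]].
- destruct V as [(L & (K & _) & _)|[(L & (K & _) & _)|((K1 & _) & (K2 & _))]]; auto.
- intros i.
  assert (Q : C1p (mix (fun z => coord (N1 z) i) (fun z => coord (N2 z) i))
    (dmix (fun z => coord (N1 z) i) (fun z => D1 z i)
      (fun z => coord (N2 z) i) (fun z => D2 z i)) x).
  { destruct V as [(L & (_ & K & _) & _)|[(L & (_ & K & _) & _)|((_ & K1 & _) & (_ & K2 & _))]];
      [apply Cl | apply Ch | apply Cm]; auto. }
  revert Q. apply C1p_ext; [now destruct i | easy].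
- unfold mix.
  destruct V as [(L & (_ & _ & K & _) & -> & _)|[(L & (_ & _ & K & _) & -> & _)|
    ((_ & _ & K1 & _) & (_ & _ & K2 & _))]].
  + now rewrite Rmult_0_l, Rplus_0_r.
  + now replace (s1 x + 1 * (s2 x - s1 x)) with (s2 x) by ring.
  + specialize (Pb x). split.
    * intros Hx. apply K1 in Hx as X1. apply K2 in Hx as X2. nra.
    * intros Hx. apply NNPP. intros Hn. rewrite K1 in Hn. apply Rnot_lt_le in Hn.
      destruct (Rlt_le_dec (s2 x) 0) as [X|X].
      -- apply K2, K1 in X. lra.
      -- nra.
- intros Hb.
  destruct V as [(L & (_ & _ & _ & K) & E0 & E1)|[(L & (_ & _ & _ & K) & E0 & E1)|
    ((_ & _ & _ & K1) & (_ & _ & _ & K2))]].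
  + destruct (K Hb) as (F1 & (lam & F2 & F3) & F4).
    unfold grad, vscale in F3. injection F3 as G1 G2 G3.
    unfold mix, dmix, grad, vscale, dot in *; simpl in *. rewrite E0.
    split; [rewrite F1; ring|]. split.
    * exists lam. split; [easy|]. rewrite !E1. f_equal; lra.
    * lra.
  + destruct (K Hb) as (F1 & (lam & F2 & F3) & F4).
    unfold grad, vscale in F3. injection F3 as G1 G2 G3.
    unfold mix, dmix, grad, vscale, dot in *; simpl in *. rewrite E0.
    split; [rewrite F1; ring|]. split.
    * exists lam. split; [easy|]. rewrite !E1. f_equal; lra.
    * lra.
  + destruct (K1 Hb) as (F1 & (lam & F2 & F3) & F4).
    destruct (K2 Hb) as (I1 & (mu & I2 & I3) & I4).
    unfold grad, vscale in F3, I3. injection F3 as G1 G2 G3. injection I3 as J1 J2 J3.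
    specialize (Pb x).
    split; [unfold mix; rewrite F1, I1; ring|]. split.
    * exists (lam + psi x * (mu - lam)). split; [nra|].
      (* The derivative of the weight multiplies a difference that vanishes on the boundary, leaving
         a convex combination of two positive multiples of [nu x]. *)
      unfold dmix, grad, vscale. rewrite F1, I1, G1, G2, G3, J1, J2, J3. f_equal; ring.
    * replace (dot _ _) with (dot (N1 x) (nu x) + psi x * (dot (N2 x) (nu x) - dot (N1 x) (nu x)))
        by (unfold mix, dot; simpl; ring).
      nra.
Qed.

(** Induction on the number of slabs: each new slab, of half-width [d], overlaps the part already
    covered in a layer of width [d], where the charts are glued. *)
Lemma has_chart_chain (S : R3 -> Prop) (j : ax) (d m K : R) :
  0 < d -> (forall x, S x -> Rabs (coord x j - m) < K) ->
  (forall s, has_chart (fun x => S x /\ Rabs (coord x j - s) < d)) ->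
  has_chart S.
Proof.
intros Hd HS H.
assert (I : forall n, has_chart (fun x => S x /\ coord x j < m - K + INR n * d)).
{ induction n as [|n IH].
  - apply (has_chart_const 1 vzero); intros x [Sx Hx]; exfalso; apply HS in Sx;
      apply Rabs_def2 in Sx; simpl in Hx; lra.
  - rewrite S_INR.
    apply (has_chart_glue _ j (m - K + INR n * d - d) (m - K + INR n * d)); [lra | |].
    + revert IH. apply has_chart_mono. tauto.
    + generalize (H (m - K + INR n * d)). apply has_chart_mono.
      intros x [[Sx H1] H2]. split; [easy|]. apply Rabs_def1; lra. }
destruct (INR_unbounded (2 * K / d)) as [n Hn].
generalize (I n). apply has_chart_mono. intros x Sx. split; [easy|].
apply HS, Rabs_def2 in Sx.
apply (Rmult_lt_compat_r d) in Hn; [|easy].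
replace (2 * K / d * d) with (2 * K) in Hn by (field; lra). lra.
Qed.

(** Compactness gives a uniform size for boxes carrying a chart; chaining such boxes along each axis
    in turn covers the large box. *)
Lemma has_chart_box (p : R3) (L : R) : has_chart (in_box p L).
Proof.
destruct (cube_compact p L (fun y d => has_chart (in_box y d))) as [d [Hd H]].
- intros t _. destruct (has_chart_local t) as [r [Hr H]].
  exists (r / 2). split; [lra|]. intros y Hy. revert H. apply has_chart_mono.
  intros x Hx i. specialize (Hx i). specialize (Hy i).
  apply Rabs_def2 in Hx. apply Rabs_def2 in Hy. apply Rabs_def1; lra.
- intros y d e H [_ He]. revert H. apply has_chart_mono.
  intros x Hx i. specialize (Hx i). lra.
- assert (Sm : forall x, has_chart (fun y => in_box p L y /\ in_box x (d / 2) y)).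
  { intros x. destruct (classic (exists z, in_box p L z /\ in_box x (d / 2) z)) as [[z [Z1 Z2]]|Hn].
    - generalize (H z (fun i => Rlt_le _ _ (Z1 i))). apply has_chart_mono.
      intros y [_ Hy] i. specialize (Hy i). specialize (Z2 i).
      apply Rabs_def2 in Hy. apply Rabs_def2 in Z2. apply Rabs_def1; lra.
    - apply (has_chart_const 1 vzero); intros y Hy; destruct Hn; now exists y. }
  apply (has_chart_chain _ A1 (d / 2) (coord p A1) L); [lra | intros x Hx; apply Hx|].
  intros s1. apply (has_chart_chain _ A2 (d / 2) (coord p A2) L);
    [lra | intros x [Hx _]; apply Hx|].
  intros s2. apply (has_chart_chain _ A3 (d / 2) (coord p A3) L);
    [lra | intros x [[Hx _] _]; apply Hx|].
  intros s3. generalize (Sm (mkR3 s1 s2 s3)). apply has_chart_mono.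
  intros x [[[Hx H1] H2] H3]. split; [easy|]. now intros [].
Qed.

(** * The sign of the normal component along rays *)

Lemma outward_of_star (x0 p : R3) (t : R) :
  vadd p (vscale t (vsub x0 p)) = vadd (vscale t x0) (vscale (1 - t) p).
Proof. unfold vadd, vscale, vsub; simpl; f_equal; ring. Qed.

Lemma small_positive (d e : R) : 0 < d -> 0 < e -> exists t, 0 < t < d /\ t < e.
Proof.
intros Hd He. exists (Rmin d e / 2). pose proof (Rmin_glb_lt d e 0 Hd He).
pose proof (Rmin_l d e). pose proof (Rmin_r d e). lra.
Qed.

(** If [v] pointed strictly outwards, the local defining function would be positive along the ray,
    hence near each of its points, so these would lie outside the closure. *)
Lemma normal_sign (p v : R3) :
  boundary Om p ->
  (forall d, 0 < d -> exists t, 0 < t < d /\ closure Om (vadd p (vscale t v))) ->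
  dot v (nu p) <= 0.
Proof.
intros Hb Hv.
destruct (boundary_chart p Hb) as (r & rho & drho & Hr & Hrho & Hn).
destruct (Hrho p (near_self _ _ (near_ball p r Hr))) as [Hd Hg].
apply Rnot_lt_le. intros H.
assert (Hg' : 0 < dot (grad drho p) v).
{ pose proof (vnorm_gt0 _ Hg) as Hk. rewrite Hn in H.
  replace (dot v _) with (/ vnorm (grad drho p) * dot (grad drho p) v) in H
    by (unfold dot, vscale; simpl; ring).
  apply Rinv_0_lt_compat in Hk. nra. }
destruct (ray_increases rho drho p v (proj1 Hd) Hg') as [d [Hd0 K]].
rewrite (boundary_rho_eq0 _ _ p Hb Hd) in K.
(* Whole neighbourhoods of the ray points are needed, since the closure is tested by points of [Om]
   off the ray. *)
destruct (near_line p v _ (near_and (near_near _ _ (proj1 Hd)) (near_near _ _ (proj2 Hd))))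
  as [s Hs].
destruct (Hv (Rmin d s) ltac:(apply Rmin_glb_lt; [easy | apply cond_pos]))
  as [t [Ht Hc]].
pose proof (Rmin_l d s). pose proof (Rmin_r d s).
assert (B : Hierarchy.ball (0 : R_UniformSpace) s t).
{ change (Rabs (t - 0) < s). rewrite Rminus_0_r, Rabs_pos_eq; lra. }
destruct (Hs t B) as [S1 S2].
specialize (K t ltac:(lra)).
assert (N := cont_gt_near _ _ _ (C1p_cont _ _ _ (near_self _ _ S1)) K).
destruct (closure_near _ _ _ Hc (near_and S2 N)) as [y [Hy [K1 K2]]].
apply K1 in Hy. lra.
Qed.

Lemma normal_sign_complement (p v : R3) :
  boundary Om p ->
  (forall d, 0 < d -> exists t, 0 < t < d /\ ~ Om (vadd p (vscale t v))) ->
  0 <= dot v (nu p).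
Proof.
intros Hb Hv.
destruct (boundary_chart p Hb) as (r & rho & drho & Hr & Hrho & Hn).
destruct (Hrho p (near_self _ _ (near_ball p r Hr))) as [Hd Hg].
apply Rnot_lt_le. intros H.
assert (Hg' : dot (grad drho p) v < 0).
{ pose proof (vnorm_gt0 _ Hg) as Hk. rewrite Hn in H.
  replace (dot v _) with (/ vnorm (grad drho p) * dot (grad drho p) v) in H
    by (unfold dot, vscale; simpl; ring).
  apply Rinv_0_lt_compat in Hk. nra. }
destruct (ray_decreases rho drho p v (proj1 Hd) Hg') as [d [Hd0 K]].
rewrite (boundary_rho_eq0 _ _ p Hb Hd) in K.
destruct (near_line p v _ (proj2 Hd)) as [s Hs].
destruct (Hv (Rmin d s) ltac:(apply Rmin_glb_lt; [easy | apply cond_pos]))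
  as [t [Ht Hc]].
pose proof (Rmin_l d s). pose proof (Rmin_r d s).
assert (B : Hierarchy.ball (0 : R_UniformSpace) s t).
{ change (Rabs (t - 0) < s). rewrite Rminus_0_r, Rabs_pos_eq; lra. }
apply Hc, (Hs t B), K. lra.
Qed.

End Boundary.

(** * The Pohozaev inequality *)

Section Pohozaev.

Variables (Om : R3 -> Prop) (nu : R3 -> R3) (u : R3 -> R3) (Du : R3 -> ax -> ax -> R)
  (x0 : R3).
Hypotheses (Om_open : is_open Om) (Om_bd : C1_boundary_outer_normal Om nu)
  (u_C1 : C1_field_with Om u Du) (u_cont : vcont_on (closure Om) u)
  (u_curl : forall x, Om x -> cross (curl Du x) (u x) = vzero)
  (u_div : forall x, Om x -> div Du x = 0).

Let X (x : R3) : R3 := vsub x x0.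

(* The stress tensor u (x) u - |u|^2/2 Id applied to X; its divergence is the
   trace of the tensor plus X . (curl u x u). *)
Definition stress_flux (x : R3) : R3 :=
  vsub (vscale (dot (u x) (X x)) (u x)) (vscale (dot (u x) (u x) / 2) (X x)).

Definition D_stress_flux (x : R3) (i j : ax) : R :=
  ((Du x A1 j * c1 (X x) + c1 (u x) * delta A1 j) +
   (Du x A2 j * c2 (X x) + c2 (u x) * delta A2 j) +
   (Du x A3 j * c3 (X x) + c3 (u x) * delta A3 j)) * coord (u x) i +
  dot (u x) (X x) * Du x i j -
  ((c1 (u x) * Du x A1 j + c2 (u x) * Du x A2 j + c3 (u x) * Du x A3 j) * coord (X x) i +
   dot (u x) (u x) / 2 * delta i j).

Lemma coord_stress_flux (x : R3) (i : ax) :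
  coord (stress_flux x) i =
  dot (u x) (X x) * coord (u x) i - dot (u x) (u x) / 2 * coord (X x) i.
Proof. now destruct i. Qed.

Lemma C1p_shift (i : ax) (x : R3) :
  C1p (fun y => coord (X y) i) (fun _ j => delta i j) x.
Proof.
eapply C1p_ext; [| | apply (C1p_minus _ _ _ _ x (C1p_coord i x) (C1p_const (coord x0 i) x))].
- intros y. symmetry. apply coord_sub.
- intros; simpl; ring.
Qed.

Lemma C1p_dot (f g : R3 -> R3) (df dg : R3 -> ax -> ax -> R) (x : R3) :
  (forall i, C1p (fun y => coord (f y) i) (fun y j => df y i j) x) ->
  (forall i, C1p (fun y => coord (g y) i) (fun y j => dg y i j) x) ->
  C1p (fun y => dot (f y) (g y)) (fun y j =>
    (df y A1 j * c1 (g y) + c1 (f y) * dg y A1 j) +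
    (df y A2 j * c2 (g y) + c2 (f y) * dg y A2 j) +
    (df y A3 j * c3 (g y) + c3 (f y) * dg y A3 j)) x.
Proof.
intros Hf Hg.
exact (C1p_plus _ _ _ _ _ (C1p_plus _ _ _ _ _
  (C1p_mult _ _ _ _ _ (Hf A1) (Hg A1)) (C1p_mult _ _ _ _ _ (Hf A2) (Hg A2)))
  (C1p_mult _ _ _ _ _ (Hf A3) (Hg A3))).
Qed.

Lemma u_C1p (x : R3) (i : ax) :
  Om x -> C1p (fun y => coord (u y) i) (fun y j => Du y i j) x.
Proof.
intros Hx. apply (C1p_of_scalar Om); [now apply near_open | apply u_C1].
Qed.

Lemma stress_flux_C1p (x : R3) (i : ax) :
  Om x -> C1p (fun y => coord (stress_flux y) i) (fun y j => D_stress_flux y i j) x.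
Proof.
intros Hx. assert (Cu := fun i => u_C1p x i Hx).
assert (M := C1p_minus _ _ _ _ _
  (C1p_mult _ _ _ _ _ (C1p_dot u X _ _ x Cu (fun i => C1p_shift i x)) (Cu i))
  (C1p_mult _ _ _ _ _ (C1p_mult _ _ _ _ _ (C1p_dot u u _ _ x Cu Cu) (C1p_const (/ 2) x))
     (C1p_shift i x))).
revert M. apply C1p_ext.
- intros y. now destruct i.
- intros y j. unfold D_stress_flux. cbv beta. field.
Qed.

(** The derivatives of [X] contribute [dot (u x) (u x)] minus three halves of it. The remaining
    terms are the divergence times [dot (u x) (X x)] plus [X x] dotted with
    [cross (curl Du x) (u x)]; both vanish. *)
Lemma stress_flux_div (x : R3) :
  Om x -> div D_stress_flux x = - dot (u x) (u x) / 2.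
Proof.
intros Hx. assert (E := u_curl x Hx). assert (E0 := u_div x Hx).
unfold cross, curl, vzero, div in *. simpl in *.
injection E as E1 E2 E3.
unfold D_stress_flux, dot. cbn [coord]. cbv beta iota delta [delta].
apply Rminus_diag_uniq.
transitivity (
  (Du x A1 A1 + Du x A2 A2 + Du x A3 A3) * dot (u x) (X x) +
  (c1 (X x) * ((Du x A1 A3 - Du x A3 A1) * c3 (u x) - (Du x A2 A1 - Du x A1 A2) * c2 (u x)) +
   c2 (X x) * ((Du x A2 A1 - Du x A1 A2) * c1 (u x) - (Du x A3 A2 - Du x A2 A3) * c3 (u x)) +
   c3 (X x) * ((Du x A3 A2 - Du x A2 A3) * c2 (u x) - (Du x A1 A3 - Du x A3 A1) * c1 (u x)))).
- unfold dot. field.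
- rewrite E0, E1, E2, E3. ring.
Qed.

(** At boundary points [u] is continuous only relative to the closure, hence the restricted
    filter. *)
Lemma lim_u (x : R3) (i : ax) :
  closure Om x ->
  filterlim (fun y => coord (u y) i) (within (closure Om) (near x)) (locally (coord (u x) i)).
Proof.
intros Hx P [e HP]. destruct (u_cont x Hx e (cond_pos e)) as [d [Hd H]].
unfold filtermap, within.
generalize (near_of_norm x d _ Hd (fun y Hy => Hy)). apply filter_imp.
intros y Hy Hc. apply HP. change (Rabs (coord (u y) i - coord (u x) i) < e).
rewrite <- coord_sub. eapply Rle_lt_trans; [apply abs_coord_le_norm|]. auto.
Qed.

Lemma lim_stress_flux (x : R3) (i : ax) :
  closure Om x ->
  filterlim (fun y => coord (stress_flux y) i) (within (closure Om) (near x))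
    (locally (coord (stress_flux x) i)).
Proof.
intros Hx. assert (Lu := fun i => lim_u x i Hx).
assert (LX : forall i, filterlim (fun y => coord (X y) i) (within (closure Om) (near x))
  (locally (coord (X x) i))).
{ intros k. apply filterlim_filter_le_1 with (2 := C1p_cont _ _ _ (C1p_shift k x)).
  apply filter_le_within. }
assert (Ld : forall f g : R3 -> R3,
  (forall i, filterlim (fun y => coord (f y) i) (within (closure Om) (near x))
    (locally (coord (f x) i))) ->
  (forall i, filterlim (fun y => coord (g y) i) (within (closure Om) (near x))
    (locally (coord (g x) i))) ->
  filterlim (fun y => dot (f y) (g y)) (within (closure Om) (near x)) (locally (dot (f x) (g x)))).
{ intros f g Hf Hg. unfold dot.
  apply lim_plus; [apply lim_plus|]; apply lim_mult;
    first [apply (Hf A1) | apply (Hf A2) | apply (Hf A3) |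
      apply (Hg A1) | apply (Hg A2) | apply (Hg A3)]. }
assert (E : forall y, dot (u y) (X y) * coord (u y) i +
  -1 * (dot (u y) (u y) * / 2 * coord (X y) i) = coord (stress_flux y) i).
{ intros y. rewrite coord_stress_flux. field. }
apply (filterlim_ext _ _ E). rewrite <- E.
apply lim_plus.
- apply lim_mult; [now apply Ld | apply Lu].
- apply lim_mult; [apply filterlim_const|].
  apply lim_mult; [apply lim_mult; [now apply Ld | apply filterlim_const] | apply LX].
Qed.

Hypothesis flux_ge0 : forall p, boundary Om p -> 0 <= dot (stress_flux p) (nu p).

(** On the boundary the flux itself may be tangential; the term in [tau] makes the product strictly
    positive there, so that it stays positive nearby in the closure. Compactness then gives a strip
    of uniform width. *)
Lemma flux_positive_strip (L tau : R) (sg : R3 -> R) (dsg : R3 -> ax -> R)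
  (N : R3 -> R3) (DN : R3 -> ax -> ax -> R) :
  0 < tau -> (forall x, in_cube x0 L x -> chart_at Om nu sg dsg N DN x) ->
  exists eps, 0 < eps /\ forall x, in_cube x0 L x -> Om x -> - eps < sg x ->
    0 <= dot (grad dsg x) (vadd (stress_flux x) (vscale tau (N x))).
Proof.
intros Ht HC.
apply (near_cube_compact x0 L (fun x e => Om x -> - e < sg x ->
  0 <= dot (grad dsg x) (vadd (stress_flux x) (vscale tau (N x))))).
- intros t Qt. destruct (HC t Qt) as ([_ Cs Cd] & CN & D & B).
  destruct (classic (Om t)) as [Ot|Ot].
  (* Near an interior point the strip condition fails for this width, so the claim is vacuous. *)
  { assert (St := proj1 D Ot). exists (- sg t / 2). split; [lra|].
    generalize (cont_lt_near _ _ (sg t / 2) Cs ltac:(lra)). apply filter_imp.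
    intros y Hy _ Hy'. lra. }
  exists 1. split; [lra|].
  destruct (classic (closure Om t)) as [Ct|Ct].
  + assert (Bt : boundary Om t).
    { split; [easy|]. now apply subset_closure. }
    destruct (B Bt) as (_ & (lam & Hl & El) & HN).
    assert (Pos : 0 < dot (grad dsg t) (vadd (stress_flux t) (vscale tau (N t)))).
    { rewrite El.
      replace (dot _ _) with (lam * (dot (stress_flux t) (nu t) + tau * dot (N t) (nu t)))
        by (unfold dot, vadd, vscale; simpl; ring).
      pose proof (flux_ge0 t Bt). apply Rmult_lt_0_compat; [easy|]. nra. }
    assert (W : forall h, cont h t -> filterlim h (within (closure Om) (near t)) (locally (h t))).
    { intros h Hh. apply filterlim_filter_le_1 with (2 := Hh). apply filter_le_within. }
    assert (Lim : filterlim (fun y => dot (grad dsg y) (vadd (stress_flux y) (vscale tau (N y))))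
      (within (closure Om) (near t))
      (locally (dot (grad dsg t) (vadd (stress_flux t) (vscale tau (N t)))))).
    { unfold dot, grad, vadd, vscale; cbn [c1 c2 c3].
      apply lim_plus; [apply lim_plus|]; apply lim_mult;
        try (apply (W (fun y => dsg y _)), Cd); apply lim_plus;
        try (apply lim_mult; [apply filterlim_const|]).
      - apply (lim_stress_flux t A1 Ct).
      - apply (W (fun y => c1 (N y))), (C1p_cont _ _ _ (CN A1)).
      - apply (lim_stress_flux t A2 Ct).
      - apply (W (fun y => c2 (N y))), (C1p_cont _ _ _ (CN A2)).
      - apply (lim_stress_flux t A3 Ct).
      - apply (W (fun y => c3 (N y))), (C1p_cont _ _ _ (CN A3)). }
    assert (Lo : locally (dot (grad dsg t) (vadd (stress_flux t) (vscale tau (N t))))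
      (fun r => 0 < r)) by (now apply (open_gt 0)).
    generalize (Lim _ Lo). unfold filtermap, within. apply filter_imp.
    intros y Hy Oy _. apply Rlt_le, Hy. now apply subset_closure.
  + destruct (not_closure_near _ _ Ct) as [d [Hd H]]. exists d. split; [easy|].
    intros y Hy Oy. exfalso. apply (H y Hy). now apply subset_closure.
- intros y d e H [_ He] Oy Hy. apply H; [easy | lra].
Qed.

(** * The radial weight *)

(* The inverse Japanese bracket of x - x0. *)
Definition jinv (x : R3) : R := / sqrt (1 + dot (X x) (X x)).

Lemma jinv_gt0 (x : R3) : 0 < jinv x.
Proof.
apply Rinv_0_lt_compat, sqrt_lt_R0. pose proof (dot_self_ge0 (X x)). lra.
Qed.

Lemma jinv_sqr (x : R3) : jinv x * jinv x * (1 + dot (X x) (X x)) = 1.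
Proof.
pose proof (dot_self_ge0 (X x)). unfold jinv.
rewrite <- Rinv_mult, sqrt_sqrt by lra. field. lra.
Qed.

Lemma jinv_C1p (x : R3) : C1p jinv (fun y j => - (jinv y) ^ 3 * coord (X y) j) x.
Proof.
set (h := fun s => / sqrt (1 + s)).
assert (Hs := dot_self_ge0 (X x)).
assert (Cd := C1p_dot X X _ _ x (fun i => C1p_shift i x) (fun i => C1p_shift i x)).
assert (Hh : derivable_pt_lim h (dot (X x) (X x)) (- / 2 * (h (dot (X x) (X x))) ^ 3)).
{ apply is_derive_Reals. unfold h.
  assert (Hq : 0 < sqrt (1 + dot (X x) (X x))) by (apply sqrt_lt_R0; lra).
  auto_derive; [split; [lra | split; [lra | easy]]|]. field. lra. }
refine (C1p_ext _ _ _ _ x _ _ (C1p_comp h (fun s => - / 2 * (h s) ^ 3) _ _ x Hh _ Cd)).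
- easy.
- intros y j. change (h (dot (X y) (X y))) with (jinv y).
  destruct j; unfold delta, coord; field.
- assert (Ch : continuity_pt h (dot (X x) (X x))).
  { apply derivable_continuous_pt. eexists. exact Hh. }
  apply continuity_pt_mult; [apply continuity_pt_const; easy|].
  apply (continuity_pt_ext (fun s => h s * (h s * h s))); [intros; ring|].
  now repeat apply continuity_pt_mult.
Qed.

(** Consequently a cutoff vanishing for [jinv < c] is zero off the cube of half-side [/ c] and on
    its faces. *)
Lemma jinv_far (c : R) (x : R3) (i : ax) :
  0 < c -> / c <= Rabs (coord x i - coord x0 i) -> jinv x < c.
Proof.
intros Hc H. apply Rnot_le_lt. intros Hj.
assert (Hs : / c * / c <= dot (X x) (X x)).
{ apply Rle_trans with (coord (X x) i * coord (X x) i).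
  - unfold X. rewrite coord_sub. set (d := coord x i - coord x0 i) in *.
    replace (d * d) with (Rabs d * Rabs d)
      by (rewrite <- Rabs_mult; apply Rabs_pos_eq, Rle_0_sqr).
    assert (0 < / c) by now apply Rinv_0_lt_compat. nra.
  - generalize (X x). intros v. unfold dot. destruct i; simpl; nra. }
pose proof (jinv_sqr x). pose proof (dot_self_ge0 (X x)).
assert (c * c * (/ c * / c) = 1) by (field; lra).
assert (c * c <= jinv x * jinv x) by nra.
assert (0 < c * c) by nra.
nra.
Qed.

(** The integrated inequality, tested on a cube where the cutoffs equal 1. The bound does not depend
    on [c]: the error density is of order [kappa * c ^ 3] on a cube of side [2 / c]. *)
Lemma energy_bound (c kappa : R) (p : R3) (r m : R) :
  0 < c -> 0 < kappa ->
  (forall x, Om x -> jinv x <= 2 * c -> dot (u x) (u x) <= kappa * jinv x ^ 2) ->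
  0 <= r ->
  (forall x, in_cube p r x ->
     Om x /\ 2 * c <= jinv x /\ m <= jinv x ^ 3 * dot (u x) (u x)) ->
  m * (2 * r) ^ 3 <= 257 * kappa.
Proof.
intros Hc Hk Hdec Hr Hp.
set (L := / c).
assert (HL : 0 < L) by now apply Rinv_0_lt_compat.
destruct (has_chart_box Om nu Om_open Om_bd x0 (L + 1)) as (sg & dsg & N & DN & HC).
assert (HC' : forall x, in_cube x0 L x -> chart_at Om nu sg dsg N DN x).
{ intros x Hx. apply HC. intros i. specialize (Hx i). lra. }
set (A := fun y => step (/ c * jinv y + -1)).
set (A' := fun y => step' (/ c * jinv y + -1)).
set (dq := fun y j => - jinv y ^ 3 * coord (X y) j).
set (chi := fun y => jinv y * A y).
set (dchi := fun y j => dq y j * A y + jinv y * (A' y * (/ c * dq y j))).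
assert (Cchi : forall x, C1p chi dchi x).
{ intros x. apply C1p_mult; [apply jinv_C1p|].
  apply (C1p_affine_comp step step' (/ c) (-1) jinv dq);
    [apply step_derive | apply step'_continuous | apply jinv_C1p]. }
assert (Far : forall x, jinv x < c -> chi x = 0 /\ forall j, dchi x j = 0).
{ intros x Hx. destruct (step_lo (/ c * jinv x + -1)) as [E E'].
  - apply (Rmult_lt_compat_l (/ c)) in Hx; [|easy].
    rewrite Rinv_l in Hx by lra. lra.
  - fold (A x) in E. fold (A' x) in E'. unfold chi, dchi. rewrite E, E'.
    split; [|intros j]; ring. }
(* [C] controls the contribution of the auxiliary field [N] to the divergence, apart from the [eta]
   terms. It is fixed before [tau], which is then chosen to make that contribution small. *)
destruct (cont_cube_bounded (fun y => chi y * div DN y + dot (grad dchi y) (N y)) x0 L)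
  as (C & HCp & HCb).
{ intros x Hx. destruct (HC' x Hx) as (_ & CN & _).
  destruct (Cchi x) as [_ C0 Cd]. unfold div, dot, grad; cbn [c1 c2 c3].
  apply cont_plus; [apply cont_mult; [easy|]; repeat apply cont_plus |
    repeat apply cont_plus; apply cont_mult].
  - apply (C1p_dcont _ _ _ (CN A1)).
  - apply (C1p_dcont _ _ _ (CN A2)).
  - apply (C1p_dcont _ _ _ (CN A3)).
  - apply Cd.
  - apply (C1p_cont _ _ _ (CN A1)).
  - apply Cd.
  - apply (C1p_cont _ _ _ (CN A2)).
  - apply Cd.
  - apply (C1p_cont _ _ _ (CN A3)). }
set (tau := kappa * c ^ 3 / (16 * C)).
assert (Hc3 : 0 < c ^ 3) by now apply pow_lt.
assert (Htau : 0 < tau).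
{ apply Rdiv_lt_0_compat; [now apply Rmult_lt_0_compat | lra]. }
destruct (flux_positive_strip L tau sg dsg N DN Htau HC') as (e1 & He1 & Hstrip).
assert (Hsub : forall y, in_cube p r y -> in_cube x0 L y).
{ intros y Hy i. apply Rnot_lt_le. intros Hn. destruct (Hp y Hy) as (_ & Hq & _).
  pose proof (jinv_far c y i Hc (Rlt_le _ _ Hn)). lra. }
(* The test cube keeps a positive distance, measured by [sg], from the boundary; this makes
   [eta = 1] on it. *)
destruct (near_cube_compact p r (fun y d => sg y <= - d)) as (e2 & He2 & Hin).
{ intros t Ht. destruct (Hp t Ht) as [Ot _].
  destruct (HC' t (Hsub t Ht)) as ([_ Cs _] & _ & D & _). apply D in Ot.
  exists (- sg t / 2). split; [lra|].
  generalize (cont_lt_near _ _ (sg t / 2) Cs ltac:(lra)). apply filter_imp.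
  intros y Hy. lra. }
{ intros y d e H [_ He]. lra. }
set (eps := Rmin e1 e2).
assert (Heps : 0 < eps) by now apply Rmin_glb_lt.
assert (Hle1 : eps <= e1) by apply Rmin_l. assert (Hle2 : eps <= e2) by apply Rmin_r.
(* With this slope [eta] is 1 for [sg <= - eps] and 0 for [sg >= - eps / 2]. *)
set (k := 2 / eps).
assert (Hk0 : 0 < k) by (apply Rdiv_lt_0_compat; lra).
assert (Ek : k * eps = 2) by (unfold k; field; lra).
set (eta := fun y => step (- k * sg y + -1)).
set (deta := fun y j => step' (- k * sg y + -1) * (- k * dsg y j)).
set (G := fun y i => coord (stress_flux y) i + tau * coord (N y) i).
set (Phi := fun i y => chi y * eta y * G y i).
set (dPhi := fun i y j => (dchi y j * eta y + chi y * deta y j) * G y i +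
  chi y * eta y * (D_stress_flux y i j + (0 * coord (N y) i + tau * DN y i j))).
set (W := fun y => chi y * eta y * (jinv y * jinv y * dot (u y) (u y))).
(* Near every point either a cutoff vanishes identically, or the point lies in [Om] and in the
   charted box, where all factors are regular. Hence the truncated field is C^1 on the whole
   space. *)
assert (Cases : forall x,
  near x (fun y => chi y = 0 /\ forall j, dchi y j = 0) \/
  near x (fun y => eta y = 0 /\ forall j, deta y j = 0) \/
  (Om x /\ in_box x0 (L + 1) x)).
{ intros x. destruct (classic (in_box x0 (L + 1) x)) as [Bx|Bx].
  - destruct (classic (Om x)) as [Ox|Ox]; [now right; right|]. right; left.
    destruct (HC x Bx) as ([_ Cs _] & _ & D & _).
    assert (Hs : - / k < sg x).
    { assert (0 < / k) by now apply Rinv_0_lt_compat.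
      destruct (Rlt_le_dec (sg x) 0) as [H'|H']; [now apply D in H' | lra]. }
    generalize (cont_gt_near _ _ _ Cs Hs). apply filter_imp. intros y Hy.
    unfold eta, deta. destruct (step_lo (- k * sg y + -1)) as [-> ->].
    + apply (Rmult_lt_compat_l k) in Hy; [|easy].
      replace (k * - / k) with (-1) in Hy by (field; lra). lra.
    + split; [easy|]. intros; ring.
  - left. apply not_all_ex_not in Bx. destruct Bx as [i Hi]. apply Rnot_lt_le in Hi.
    assert (Ci : cont (fun y => Rabs (coord y i - coord x0 i)) x).
    { apply cont_comp; [apply Rcontinuity_abs|].
      apply cont_minus; [apply cont_coord | apply cont_const]. }
    generalize (cont_gt_near _ _ L Ci ltac:(lra)). apply filter_imp.
    intros y Hy. apply Far, (jinv_far c y i Hc). fold L. lra. }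
assert (Ceta : forall x, in_box x0 (L + 1) x -> C1p eta deta x).
{ intros x Bx. apply (C1p_affine_comp step step' (- k) (-1) sg dsg);
    [apply step_derive | apply step'_continuous | apply (HC x Bx)]. }
assert (CPhi : forall i x, C1p (Phi i) (dPhi i) x).
{ intros i x. destruct (Cases x) as [H|[H|[Ox Bx]]].
  - apply (C1p_ext_near (fun _ => 0) _ (fun _ _ => 0)); [|apply C1p_const].
    revert H. apply filter_imp. intros y [E E']. unfold Phi, dPhi. rewrite E.
    split; [ring | intros j; rewrite E'; ring].
  - apply (C1p_ext_near (fun _ => 0) _ (fun _ _ => 0)); [|apply C1p_const].
    revert H. apply filter_imp. intros y [E E']. unfold Phi, dPhi. rewrite E.
    split; [ring | intros j; rewrite E'; ring].
  - apply C1p_mult; [apply C1p_mult; auto|]. apply C1p_plus.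
    + now apply stress_flux_C1p.
    + apply (C1p_mult (fun _ => tau) _ (fun _ _ => 0)); [apply C1p_const|].
      apply (HC x Bx). }
assert (CW : forall x, cont W x).
{ intros x. destruct (Cases x) as [H|[H|[Ox Bx]]].
  - apply (cont_ext_near (fun _ => 0)); [|apply cont_const].
    revert H. apply filter_imp. intros y [E _]. unfold W. rewrite E. ring.
  - apply (cont_ext_near (fun _ => 0)); [|apply cont_const].
    revert H. apply filter_imp. intros y [E _]. unfold W. rewrite E. ring.
  - assert (Cu := fun i => u_C1p x i Ox).
    apply cont_mult; apply cont_mult.
    + apply (C1p_cont _ _ _ (Cchi x)).
    + apply (C1p_cont _ _ _ (Ceta x Bx)).
    + apply cont_mult; apply (C1p_cont _ _ _ (jinv_C1p x)).
    + apply (C1p_cont _ _ _ (C1p_dot u u _ _ x Cu Cu)). }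
assert (I0 : forall i, int_cube x0 L (fun y => dPhi i y i) = 0).
{ intros i. apply (int_cube_partial x0 L (Rlt_le _ _ HL) i (Phi i)).
  - intros y. apply (C1p_cont _ _ _ (CPhi i y)).
  - intros y. apply (C1p_dcont _ _ _ (CPhi i y)).
  - intros y. apply (C1p_partial _ _ _ (CPhi i y)).
  - intros y Hy. unfold Phi. destruct (Far y) as [-> _]; [|ring].
    apply (jinv_far c y i Hc). fold L. lra. }
assert (CdPhi : forall i y, cont (fun z => dPhi i z i) y).
{ intros i y. apply (C1p_dcont _ _ _ (CPhi i y)). }
set (K := 32 * kappa * c ^ 3 + 2 * tau * C).
(* [V] is [K] minus twice the divergence of [Phi], so only [K] contributes to its integral. *)
set (V := fun y => -2 * dPhi A1 y A1 + (-2 * dPhi A2 y A2 + (-2 * dPhi A3 y A3 + K))).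
assert (IV : int_cube x0 L V = K * (2 * L) ^ 3).
{ unfold V.
  assert (C3 : forall y, cont (fun z => -2 * dPhi A3 z A3 + K) y).
  { intros y. apply cont_plus; [|apply cont_const].
    apply cont_mult; [apply cont_const | apply CdPhi]. }
  rewrite (int_cube_lin x0 L (Rlt_le _ _ HL) (-2) (fun y => dPhi A1 y A1)
    (fun y => -2 * dPhi A2 y A2 + (-2 * dPhi A3 y A3 + K))); [ | apply CdPhi | ].
  2:{ intros y. apply cont_plus; [apply cont_mult; [apply cont_const | apply CdPhi]|apply C3]. }
  rewrite (int_cube_lin x0 L (Rlt_le _ _ HL) (-2) (fun y => dPhi A2 y A2)
    (fun y => -2 * dPhi A3 y A3 + K)); [ | apply CdPhi | apply C3].
  rewrite (int_cube_lin x0 L (Rlt_le _ _ HL) (-2) (fun y => dPhi A3 y A3)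
    (fun y => K)); [ | apply CdPhi | intros; apply cont_const].
  rewrite !I0, int_cube_const by lra. ring. }
assert (Hchi : forall y, 0 <= chi y).
{ intros y. apply Rmult_le_pos; [apply Rlt_le, jinv_gt0 | apply step_bounds]. }
assert (HK : 0 <= K).
{ unfold K. assert (0 < kappa * c ^ 3) by now apply Rmult_lt_0_compat.
  assert (0 < tau * C) by now apply Rmult_lt_0_compat. lra. }
assert (Pw : forall y, in_cube x0 L y -> W y <= V y).
{ intros y Qy. destruct (Rle_lt_dec (- k * sg y + -1) 0) as [Ht|Ht].
  { destruct (step_lo _ Ht) as [Z Z']. fold (eta y) in Z.
    assert (Zd : forall j, deta y j = 0) by (intros j; unfold deta; rewrite Z'; ring).
    unfold W, V, dPhi. rewrite Z, !Zd.
    match goal with |- _ <= ?e => replace e with K by ring end. lra. }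
  assert (Oy : Om y).
  { apply (HC' y Qy). apply Rnot_le_lt. intros H. nra. }
  (* The term with the gradient of [eta] has a sign: [step'] is nonzero only for
     [- eps < sg y < - eps / 2], inside the strip. *)
  assert (HE : step' (- k * sg y + -1) * (- k) *
    dot (grad dsg y) (vadd (stress_flux y) (vscale tau (N y))) <= 0).
  { pose proof (step'_bounds (- k * sg y + -1)) as Sb.
    destruct (Req_dec (step' (- k * sg y + -1)) 0) as [->|Hs]; [lra|].
    apply step'_ne0 in Hs.
    assert (H := Hstrip y Qy Oy ltac:(nra)).
    assert (0 <= step' (- k * sg y + -1) * k) by nra.
    nra. }
  set (Ev := step' (- k * sg y + -1) * (- k) *
    dot (grad dsg y) (vadd (stress_flux y) (vscale tau (N y)))) in *.
  set (Bn := chi y * div DN y + dot (grad dchi y) (N y)).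
  assert (HBn : Rabs Bn <= C) by now apply HCb.
  set (U := dot (u y) (u y)). set (s := dot (X y) (X y)). set (w := dot (u y) (X y)).
  set (q := jinv y). set (a := A y). set (a' := A' y).
  (* The gradient of [chi] at [y] is [- beta] times [X y]. *)
  set (beta := q ^ 3 * a + q * (a' * (/ c * q ^ 3))).
  assert (Hdiv := stress_flux_div y Oy). fold U in Hdiv.
  assert (Sum : V y = -2 * (eta y * (q * a * (- U / 2) - beta * (w * w - s * U / 2)) +
    tau * eta y * Bn + q * a * Ev) + K).
  { rewrite <- Hdiv. unfold V, dPhi, G, deta, Bn, Ev, div, dot, grad, vadd, vscale.
    cbn [c1 c2 c3].
    replace (w * w - s * U / 2) with (c1 (X y) * coord (stress_flux y) A1 +
      c2 (X y) * coord (stress_flux y) A2 + c3 (X y) * coord (stress_flux y) A3).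
    2:{ rewrite !coord_stress_flux. unfold w, s, U, dot. cbn [coord]. field. }
    unfold dchi, dq, beta, chi. fold q a a'. cbn [coord]. ring. }
  rewrite Sum. unfold W, chi. fold q a U.
  assert (Hq : 0 < q) by apply jinv_gt0.
  assert (Hqs : q * q * (1 + s) = 1) by apply jinv_sqr.
  assert (Hs0 : 0 <= s) by apply dot_self_ge0.
  assert (HU0 : 0 <= U) by apply dot_self_ge0.
  assert (Ha : 0 <= a <= 1) by apply step_bounds.
  assert (Ha' : 0 <= a' <= 2) by apply step'_bounds.
  assert (Het : 0 <= eta y <= 1) by apply step_bounds.
  set (et := eta y) in *.
  assert (Hic : 0 < / c) by exact HL.
  assert (Hb : 0 <= beta).
  { unfold beta. assert (0 <= q ^ 3) by (apply pow_le; lra).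
    apply Rplus_le_le_0_compat; [apply Rmult_le_pos; lra|].
    repeat apply Rmult_le_pos; lra. }
  (* Criticality of the weight: since [q ^ 2 * (1 + s) = 1], the leading parts of [q * a] and
     [beta * s] cancel. What remains is [q ^ 3 * a], a cutoff error and a nonnegative term. *)
  assert (Eb : q * a - beta * s = q ^ 3 * a - q * q * a' * / c + q ^ 4 * a' * / c).
  { unfold beta. replace (q * a) with (q * a * (q * q * (1 + s))) by (rewrite Hqs; ring).
    replace (q * q * a' * / c) with (q * q * a' * / c * (q * q * (1 + s))) by (rewrite Hqs; ring).
    ring. }
  (* Where [a'] is nonzero, [q <= 2 * c]; so [U <= 4 * kappa * c ^ 2], [q * q <= 4 * c ^ 2] and
     [a' <= 2], whose product over [c] gives the factor 32. *)
  assert (H1 : U * (q * q * a' * / c) <= 32 * kappa * c ^ 3).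
  { destruct (Req_dec a' 0) as [->|Hn].
    { replace (U * (q * q * 0 * / c)) with 0 by ring.
      assert (0 < kappa * c ^ 3) by now apply Rmult_lt_0_compat. lra. }
    apply step'_ne0 in Hn. fold q in Hn.
    assert (Hq2 : q <= 2 * c).
    { apply (Rmult_le_reg_l (/ c)); [easy|].
      replace (/ c * (2 * c)) with 2 by (field; lra). lra. }
    assert (HUq := Hdec y Oy Hq2). fold U q in HUq.
    assert (Hqq : q * q <= 4 * c ^ 2) by nra.
    assert (Hc2 : 0 < c ^ 2) by now apply pow_lt.
    assert (HU2 : U <= kappa * (4 * c ^ 2)).
    { eapply Rle_trans; [apply HUq|]. apply Rmult_le_compat_l; [lra|].
      replace (q ^ 2) with (q * q) by ring. easy. }
    replace (32 * kappa * c ^ 3) with (kappa * (4 * c ^ 2) * (4 * c ^ 2 * 2 * / c))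
      by (field; lra).
    apply Rmult_le_compat; [easy | repeat apply Rmult_le_pos; lra | easy |].
    apply Rmult_le_compat_r; [lra|].
    apply Rmult_le_compat; [apply Rmult_le_pos; lra | lra | easy | lra]. }
  assert (H2 : Rabs (et * Bn) <= C).
  { rewrite Rabs_mult, (Rabs_pos_eq et) by lra. pose proof (Rabs_pos Bn). nra. }
  assert (H3 : tau * (et * Bn) <= tau * C).
  { apply Rmult_le_compat_l; [lra|]. now apply Rabs_le_between in H2. }
  assert (H4 : q * a * Ev <= 0).
  { assert (0 <= q * a) by (apply Rmult_le_pos; lra). nra. }
  assert (H5 : 0 <= et * (beta * (w * w))).
  { apply Rmult_le_pos; [lra|]. apply Rmult_le_pos; [lra | apply Rle_0_sqr]. }
  assert (H6 : 0 <= et * (U * (q ^ 4 * a' * / c))).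
  { repeat apply Rmult_le_pos; try lra. }
  assert (H7 : et * (U * (q * q * a' * / c)) <= 32 * kappa * c ^ 3).
  { apply Rle_trans with (1 * (U * (q * q * a' * / c))); [|lra].
    apply Rmult_le_compat_r; [|lra].
    repeat apply Rmult_le_pos; lra. }
  assert (E8 : et * U * (q * a - beta * s) =
    et * U * (q ^ 3 * a - q * q * a' * / c + q ^ 4 * a' * / c)) by (now rewrite Eb).
  unfold K.
  replace (-2 * (et * (q * a * (- U / 2) - beta * (w * w - s * U / 2)) +
    tau * et * Bn + q * a * Ev)) with
    (et * U * (q * a - beta * s) + 2 * (et * (beta * (w * w))) - 2 * (tau * (et * Bn))
     - 2 * (q * a * Ev)) by field.
  rewrite E8.
  replace (q * a * et * (q * q * U)) with (et * U * (q ^ 3 * a)) by ring.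
  lra. }
assert (Up : int_cube x0 L W <= K * (2 * L) ^ 3).
{ rewrite <- IV. apply int_cube_le; [lra | easy | | easy].
  intros y. unfold V.
  repeat (apply cont_plus; [apply cont_mult; [apply cont_const | apply CdPhi]|]).
  apply cont_const. }
(* On the test cube both cutoffs are 1, so [W] is there the weighted energy density bounded below by
   [m]. *)
assert (Lo : m * (2 * r) ^ 3 <= int_cube x0 L W).
{ apply (int_cube_lower x0 L (Rlt_le _ _ HL) W p r m); try easy.
  - intros y _. unfold W. pose proof (jinv_gt0 y). pose proof (dot_self_ge0 (u y)).
    repeat apply Rmult_le_pos; auto; try lra; apply step_bounds.
  - intros y Hy. destruct (Hp y Hy) as (_ & Hq & Hm). unfold W, chi, A, eta.
    destruct (step_hi (/ c * jinv y + -1)) as [-> _].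
    { apply (Rmult_le_compat_l (/ c)) in Hq; [|exact (Rlt_le _ _ HL)].
      replace (/ c * (2 * c)) with 2 in Hq by (field; lra). lra. }
    destruct (step_hi (- k * sg y + -1)) as [-> _].
    { specialize (Hin y Hy). cbv beta in Hin.
      assert (k * eps <= k * - sg y) by (apply Rmult_le_compat_l; lra). lra. }
    lra. }
(* Here [2 * tau * C = kappa * c ^ 3 / 8] and [(2 * L) ^ 3 = 8 / c ^ 3], whence 256 + 1. *)
replace (K * (2 * L) ^ 3) with (257 * kappa) in Up; [lra|].
unfold K, L, tau. field. lra.
Qed.

(** A nonzero value at [p] gives a fixed positive energy on a small cube, while decay allows [kappa]
    in [energy_bound] to be arbitrarily small. *)
Lemma field_vanishes (p : R3) : decay_o_inv Om u -> Om p -> u p = vzero.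
Proof.
intros Hdec Op. apply NNPP. intros Hu. apply dot_self_gt0 in Hu.
set (f := fun y => jinv y * jinv y * jinv y * dot (u y) (u y)).
assert (Cu := fun i => u_C1p p i Op).
assert (Cj := C1p_cont _ _ _ (jinv_C1p p)).
assert (Cf : cont f p).
{ apply cont_mult; [now repeat apply cont_mult|].
  apply (C1p_cont _ _ _ (C1p_dot u u _ _ p Cu Cu)). }
assert (Hj := jinv_gt0 p).
assert (Hf : 0 < f p) by (unfold f; repeat apply Rmult_lt_0_compat; easy).
destruct (near_and (near_open Om p Om_open Op)
  (near_and (cont_gt_near f p (f p / 2) Cf ltac:(lra))
    (cont_gt_near jinv p (jinv p / 2) Cj ltac:(lra)))) as (d & Hd & Hnear).
set (m := f p / 2) in *. set (r := d / 2). set (K := m * (2 * r) ^ 3).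
assert (HK : 0 < K).
{ unfold K. apply Rmult_lt_0_compat; [unfold m; lra|]. apply pow_lt. unfold r. lra. }
(* With [kappa = 4 * (e * e)] and [e <= 1], the bound is at most [1028 * e <= K / 2], which
   contradicts [0 < K]; 2056 is twice 1028. *)
set (e := Rmin 1 (K / 2056)).
assert (He : 0 < e) by (apply Rmin_glb_lt; lra).
assert (He1 : e <= 1) by apply Rmin_l. assert (HeK : e <= K / 2056) by apply Rmin_r.
destruct (Hdec e He) as [M HM].
set (n0 := dot x0 x0). assert (Hn0 : 0 <= n0) by apply dot_self_ge0.
(* [Z] is large enough that [Z <= 1 + s] forces both [M < vnorm x] and [1 + s <= 4 * n], which
   compares distances from [x0] and from the origin. *)
set (Z := 3 + 4 * n0 + 2 * (M * M)).
assert (HZ : 1 <= Z) by (unfold Z; pose proof (Rle_0_sqr M); unfold Rsqr in *; lra).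
assert (HZi : 0 < / Z) by (apply Rinv_0_lt_compat; lra).
assert (EZ : / Z * Z = 1) by (field; lra).
(* The first bound puts the cube around [p] in the region [2 * c <= jinv]; the second makes
   [jinv x <= 2 * c] imply [Z <= 1 + s]. *)
set (c := Rmin (jinv p / 4) (/ Z / 2)).
assert (Hc : 0 < c) by (apply Rmin_glb_lt; lra).
assert (Hc1 : c <= jinv p / 4) by apply Rmin_l.
assert (Hc2 : c <= / Z / 2) by apply Rmin_r.
assert (B : K <= 257 * (4 * (e * e))).
{ apply (energy_bound c (4 * (e * e)) p r m Hc).
  - assert (0 < e * e) by now apply Rmult_lt_0_compat. lra.
  - intros x Ox Hq. set (q := jinv x) in *.
    assert (Hq0 : 0 < q) by apply jinv_gt0.
    assert (Hqs : q * q * (1 + dot (X x) (X x)) = 1) by apply jinv_sqr.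
    set (s := dot (X x) (X x)) in *. set (n := dot x x).
    assert (Hn : s <= 2 * n + 2 * n0).
    { pose proof (dot_self_ge0 (vadd x x0)).
      apply Rminus_le. replace (s - (2 * n + 2 * n0)) with (- dot (vadd x x0) (vadd x x0));
        [lra | unfold s, n, n0, X, dot, vadd, vsub; simpl; ring]. }
    assert (HZs : Z <= 1 + s).
    { assert (q * q <= / Z) by nra.
      apply Rnot_lt_le. intros Hlt. assert (0 < q * q) by nra.
      assert (q * q * (1 + s) < q * q * Z) by (apply Rmult_lt_compat_l; lra).
      nra. }
    assert (Hx : M < vnorm x).
    { apply Rnot_le_lt. intros Hle.
      assert (En : vnorm x * vnorm x = n) by (apply sqrt_sqrt, dot_self_ge0).
      pose proof (sqrt_pos (dot x x)) as Hp0. fold (vnorm x) in Hp0.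
      assert (n <= M * M) by (rewrite <- En; apply Rmult_le_compat; lra).
      unfold Z in HZs. lra. }
    assert (Hb := HM x Ox Hx).
    assert (Hnu : n * dot (u x) (u x) <= e * e).
    { unfold n. rewrite <- (sqrt_sqrt (dot x x)), <- (sqrt_sqrt (dot (u x) (u x)))
        by apply dot_self_ge0.
      fold (vnorm x) (vnorm (u x)).
      assert (0 <= vnorm x * vnorm (u x)) by (apply Rmult_le_pos; apply sqrt_pos).
      nra. }
    assert (HU := dot_self_ge0 (u x)). set (U := dot (u x) (u x)) in *.
    assert (Hs4 : 1 + s <= 4 * n).
    { pose proof (Rle_0_sqr M). unfold Rsqr in *. unfold Z in HZs. lra. }
    replace U with (q * q * ((1 + s) * U)) by (rewrite <- Rmult_assoc, Hqs; ring).
    replace (4 * (e * e) * q ^ 2) with (q * q * (4 * (e * e))) by ring.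
    apply Rmult_le_compat_l; [nra|].
    apply Rle_trans with (4 * n * U); [now apply Rmult_le_compat_r | lra].
  - unfold r. lra.
  - intros x Hx. destruct (Hnear x) as (Ox & H1 & H2).
    { intros i. specialize (Hx i). unfold r in Hx. lra. }
    split; [easy|]. split; [lra|]. unfold f in H1.
    replace (jinv x ^ 3) with (jinv x * jinv x * jinv x) by ring. lra. }
assert (e * e <= e) by nra. lra.
Qed.

End Pohozaev.

(** * Both alternatives reduced to nonnegativity of the boundary flux *)

Theorem theorem2 (Om : R3 -> Prop) (nu : R3 -> R3) (u : R3 -> R3)
  (Du : R3 -> ax -> ax -> R) :
  domain Om ->
  unbounded Om ->
  C1_boundary_outer_normal Om nu ->
  (exists x, ~ closure Om x) ->
  C1_field_with Om u Du ->
  vcont_on (closure Om) u ->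
  (forall x, Om x -> cross (curl Du x) (u x) = vzero) ->
  (forall x, Om x -> div Du x = 0) ->
  decay_o_inv Om u ->
  ( (star_shaped Om /\ (forall p, boundary Om p -> cross (u p) (nu p) = vzero))
    \/
    (exists D : R3 -> Prop, domain D /\ star_shaped D /\
       (forall x, Om x <-> ~ closure D x) /\
       (forall p, boundary Om p -> dot (u p) (nu p) = 0)) ) ->
  forall x, Om x -> u x = vzero.
Proof.
intros (_ & Ho & _) _ Hbd _ HC1 Hcont Hcurl Hdiv Hdec Halt x Ox.
assert (E : forall x0 p, dot (stress_flux u x0 p) (nu p) =
  dot (u p) (vsub p x0) * dot (u p) (nu p) +
  dot (u p) (u p) / 2 * dot (vsub x0 p) (nu p)).
{ intros x0 p. unfold stress_flux, dot, vsub, vscale. cbn [c1 c2 c3]. field. }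
destruct Halt as [[(x0 & _ & Hs) Hu]|(D & _ & (x0 & _ & Hs) & HD & Hu)];
  apply (field_vanishes Om nu u Du x0); try easy; intros p Hp; rewrite E;
  assert (HU := dot_self_ge0 (u p)).
- assert (Hn : dot (vsub x0 p) (nu p) <= 0).
  { apply (normal_sign Om nu Ho Hbd p _ Hp). intros d Hd.
    destruct (small_positive d 1 Hd Rlt_0_1) as (t & Ht & Ht1).
    exists t. split; [easy|]. rewrite outward_of_star. apply Hs; [apply Hp | lra]. }
  (* The Binet-Cauchy identity for [cross (u p) (nu p)] and [cross (vsub p x0) (u p)]. It turns the
     flux into half of [dot (u p) (u p)] times the normal component of [p - x0], which is
     nonnegative. *)
  assert (Hc : dot (u p) (vsub p x0) * dot (u p) (nu p) =
    - (dot (u p) (u p) * dot (vsub x0 p) (nu p))).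
  { apply Rminus_diag_uniq.
    transitivity (dot (cross (u p) (nu p)) (cross (vsub p x0) (u p))).
    - unfold dot, cross, vsub; simpl; ring.
    - rewrite Hu by easy. unfold dot, vzero; simpl; ring. }
  rewrite Hc. nra.
- assert (Hn : 0 <= dot (vsub x0 p) (nu p)).
  { apply (normal_sign_complement Om nu Ho Hbd p _ Hp). intros d Hd.
    destruct (small_positive d 1 Hd Rlt_0_1) as (t & Ht & Ht1).
    exists t. split; [easy|]. rewrite outward_of_star.
    (* The point [p] is outside [Om], hence in the closure of [D]; star-shapedness keeps the segment
       towards [x0] there, outside [Om]. *)
    rewrite HD. intros Hn. apply Hn. apply Hs; [|lra].
    apply NNPP. rewrite <- HD. now apply boundary_not_in. }
  rewrite Hu by easy. nra.
Qed.
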